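(* Let $G$ be a plane graph whose set of vertices has no accumulation point in $\mathbb{R}^2$ and which has bounded vertex degrees. If $G$ is hyperbolic and weakly non-amenable, then there exists $k$ such that for every cycle $C\subset G$ the number of faces of $G$ inside $C$ is at most $k|C|$.
   Context: A plane graph is a graph with a fixed embedding in $\mathbb{R}^2$ with no two edges crossing. A face is a connected component of $\mathbb{R}^2$ minus the image of the graph; a face is inside a cycle $C$ if it lies in the bounded component of $\mathbb{R}^2\setminus C$. For finite $S\subset V(G)$, $\partial S$ is the set of vertices outside $S$ adjacent to a vertex of $S$; $G$ is weakly non-amenable if there is a monotone increasing diverging $f:\mathbb{N}\to\mathbb{N}$ with $|S|\le f(|\partial S|)$ for all non-empty finite $S$. A graph is hyperbolic if there is $\delta\ge0$ such that in each connected component every geodetic triangle (three vertices joined pairwise by geodesics) has each side in the $\delta$-neighbourhood of the union of the other two. *)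

(* Defs.v *)
From HB Require Import structures.
From mathcomp Require Import all_boot all_order all_algebra.
From mathcomp Require Import all_classical all_reals all_analysis.
Set Implicit Arguments. Unset Strict Implicit. Unset Printing Implicit Defensive.
Import Order.TTheory GRing.Theory Num.Theory.
Import numFieldNormedType.Exports.
Local Open Scope classical_set_scope.
Local Open Scope ring_scope.

Section Defs.
Variable R : realType.
Variable V : eqType.
Variable adj : V -> V -> Prop.

Fixpoint chain (x : V) (s : seq V) : Prop :=
  if s is y :: s' then adj x y /\ chain y s' else True.

Definition gdist (u v : V) (n : nat) : Prop :=
  (exists s, [/\ chain u s, last u s = v & size s = n]) /\
  (forall s, chain u s -> last u s = v -> (n <= size s)%N).

Definition geodesic (u v : V) (s : seq V) : Prop :=
  [/\ chain u s, last u s = v & gdist u v (size s)].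

Definition hyperbolic : Prop :=
  exists delta : nat, forall (x y z : V) (sxy syz szx : seq V),
    geodesic x y sxy -> geodesic y z syz -> geodesic z x szx ->
    forall w, w \in x :: sxy ->
      exists w', (w' \in y :: syz \/ w' \in z :: szx) /\
                 exists d, gdist w w' d /\ (d <= delta)%N.

Definition bounded_degree : Prop :=
  exists D : nat, forall (v : V) (s : seq V),
    uniq s -> (forall w, w \in s -> adj v w) -> (size s <= D)%N.

Definition is_boundary (s b : seq V) : Prop :=
  uniq b /\ forall x, x \in b <-> (x \notin s /\ exists y, y \in s /\ adj x y).

(* |S| <= f |dS| for all non-empty finite S (vacuous if dS is infinite) *)
Definition weakly_nonamenable : Prop :=
  exists f : nat -> nat,
    [/\ (forall m n, (m <= n)%N -> (f m <= f n)%N),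
        (forall M, exists n, (M <= f n)%N) &
        forall s b : seq V, uniq s -> s != [::] -> is_boundary s b ->
          (size s <= f (size b))%N].

Variable pos : V -> R * R.
Variable arc : V -> V -> R -> R * R.

Definition edge_img (u v : V) : set (R * R) := arc u v @` [set t | t \in `[0, 1]].

Definition is_plane_graph : Prop :=
  [/\ (forall u v, adj u v -> adj v u) /\ (forall u, ~ adj u u),
      injective pos,
      (forall u v, adj u v ->
         [/\ {within `[(0:R), 1], continuous (arc u v)},
             (forall s t, s \in `[0, 1] -> t \in `[0, 1] ->
                arc u v s = arc u v t -> s = t),
             arc u v 0 = pos u, arc u v 1 = pos v &
             edge_img u v = edge_img v u]),
      (forall u v w t, adj u v -> t \in `]0, 1[%R -> arc u v t <> pos w) &
      (forall u v x y p, adj u v -> adj x y ->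
         ~ ((u = x /\ v = y) \/ (u = y /\ v = x)) ->
         edge_img u v p -> edge_img x y p ->
         exists w, [/\ w = u \/ w = v, w = x \/ w = y & p = pos w])].

Definition no_accumulation : Prop :=
  forall p : R * R, exists e : R, 0 < e /\
    forall v, `|(pos v).1 - p.1| < e -> `|(pos v).2 - p.2| < e -> pos v = p.

Definition graph_img : set (R * R) :=
  [set p | (exists v, p = pos v) \/ exists u v, adj u v /\ edge_img u v p].

Definition is_cycle (x : V) (s : seq V) : Prop :=
  [/\ uniq (x :: s), (2 <= size s)%N & chain x (rcons s x)].

Definition cycle_img (x : V) (s : seq V) : set (R * R) :=
  [set p | exists e, e \in zip (x :: s) (rcons s x) /\ edge_img e.1 e.2 p].

Definition bounded2 (A : set (R * R)) : Prop :=
  exists M : R, forall q, A q -> `|q.1| <= M /\ `|q.2| <= M.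

Definition inside (C : set (R * R)) : set (R * R) :=
  [set p | ~ C p /\ bounded2 (connected_component (~` C) p)].

Definition face (p : R * R) : set (R * R) :=
  connected_component (~` graph_img) p.

(* ps lists representatives of pairwise distinct faces, all inside C *)
Definition distinct_faces_inside (C : set (R * R)) (ps : seq (R * R)) : Prop :=
  (forall p, p \in ps -> ~ graph_img p /\ face p `<=` inside C) /\
  (forall i j, (i < size ps)%N -> (j < size ps)%N -> i <> j ->
     ~ face (nth 0 ps i) (nth 0 ps j)).

End Defs.

(* Main.v *)
(** Hyperbolicity (Dehn's algorithm): a closed walk that is not a point has a
    subwalk of bounded length that is not geodesic, and replacing it by a geodesic
    shortens the walk. Hence the cycle [C] is a sum, in the cycle space, of at most
    [|C|] closed walks [W] of bounded length. Winding numbers are additive, and by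
    Borsuk's argument (Tietze extension and the non-existence of a retraction of
    the disc onto its boundary) [C] winds around every point of a bounded component
    of its complement; so every face inside [C] has non-zero winding number with
    respect to some [W].

    For one such [W], the vertices with non-zero winding number form a finite set
    whose boundary lies on [W], so weak non-amenability bounds their number, and
    hence the number of edges among them and [W]. Finally, a finite plane graph has
    at most as many bounded complementary components as edges: integer angle
    defects along the edges of more components than edges would be linearly
    dependent, producing a non-trivial combination of the angle functions
    [arg (z - q_i)] with a continuous logarithm, which Borsuk's argument excludes.

    Maps to the circle are handled as real functions modulo [2 * pi]: continuity
    means continuity of their cosine and sine. *)
Require Import Defs.
From HB Require Import structures.
From mathcomp Require Import all_boot all_order all_algebra.
From mathcomp Require Import all_classical all_reals all_analysis.
From mathcomp Require Import lra ring zify.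
Import Order.TTheory GRing.Theory Num.Theory.
Import numFieldNormedType.Exports.
Local Open Scope classical_set_scope.
Local Open Scope ring_scope.
Set Implicit Arguments. Unset Strict Implicit. Unset Printing Implicit Defensive.

(** * Angles modulo [2 * pi] *)

Section WithinContinuity.
Context {R : realType} {T : topologicalType}.
Implicit Types (K A B : set T) (f g : T -> R).

Lemma withinP K f : {within K, continuous f} <->
  forall z, K z -> f x @[x --> within K (nbhs z)] --> f z.
Proof. exact: (@subspace_continuousP _ K _ f). Qed.

Lemma within_setT f : {within setT, continuous f} -> continuous f.
Proof. by move=> h; exact: (@continuous_subspace_setT _ _ f).2. Qed.

Lemma within_eq K f g : (forall z, K z -> f z = g z) ->
  {within K, continuous f} -> {within K, continuous g}.
Proof.
move=> e /withinP cf; apply/withinP => z Kz.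
rewrite -(e _ Kz); apply: cvg_trans (cf z Kz); apply: near_eq_cvg.
by near=> x; rewrite e//; near: x; exact: withinT.
Unshelve. all: by end_near. Qed.

Lemma within_cst K (a : R) : {within K, continuous (fun=> a)}.
Proof. by apply: continuous_subspaceT => x; exact: cvg_cst. Qed.

Lemma within_add K f g : {within K, continuous f} -> {within K, continuous g} ->
  {within K, continuous (fun z => f z + g z)}.
Proof.
move=> /withinP cf /withinP cg.
apply/withinP => z Kz.
by apply: cvgD; [exact: cf|exact: cg].
Qed.

Lemma within_opp K f : {within K, continuous f} ->
  {within K, continuous (fun z => - f z)}.
Proof.
move=> /withinP cf.
by apply/withinP => z Kz; apply: cvgN; exact: cf.
Qed.

Lemma within_mul K f g : {within K, continuous f} -> {within K, continuous g} ->
  {within K, continuous (fun z => f z * g z)}.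
Proof.
move=> /withinP cf /withinP cg.
apply/withinP => z Kz.
by apply: cvgM; [exact: cf|exact: cg].
Qed.

Lemma within_comp K f (h : R -> R) : {within K, continuous f} -> continuous h ->
  {within K, continuous (fun z => h (f z))}.
Proof.
move=> /withinP cf ch; apply/withinP => z Kz.
apply: (cvg_comp _ h); first exact: cf.
exact: ch.
Qed.

Lemma within_max K f (a : R) : {within K, continuous f} ->
  {within K, continuous (fun z => Num.max a (f z))}.
Proof.
move=> cf; apply: (within_comp (h := fun x => Num.max a x)) => // x.
by apply: continuous_max; [exact: cvg_cst|exact: cvg_id].
Qed.

Lemma within_inv K f : (forall z, K z -> f z != 0) -> {within K, continuous f} ->
  {within K, continuous (fun z => (f z)^-1)}.
Proof.
move=> fn0 /withinP cf.
by apply/withinP => z Kz; apply: cvgV; [exact: fn0|exact: cf].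
Qed.

Lemma within_sum K (I : Type) (r : seq I) (F : I -> T -> R) :
  (forall i, {within K, continuous (F i)}) ->
  {within K, continuous (fun z => \sum_(i <- r) F i z)}.
Proof.
move=> cF; elim: r => [|i r IH].
  by apply: (within_eq _ (@within_cst K 0)) => z _; rewrite big_nil.
by apply: (within_eq _ (within_add (cF i) IH)) => z _; rewrite big_cons.
Qed.

End WithinContinuity.

Section Angles.
Context {R : realType}.
Implicit Types a b c x y : R.

(** Congruence modulo [2 * pi], encoded without an integer witness; [eqang_int] recovers the
    witness. *)
Definition eqang a b := cos (a - b) = 1.

Lemma eqang_refl a : eqang a a.
Proof. by rewrite /eqang subrr cos0. Qed.

Lemma eqangE a b : eqang a b <-> cos a = cos b /\ sin a = sin b.
Proof.
rewrite /eqang; split=> [h|[hc hs]].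
  have s0 : sin (a - b) = 0 by apply: cos1sin0; rewrite h normr1.
  rewrite -(subrK b a); move: (a - b) h s0 => d h s0.
  by rewrite cosD sinD h s0 !mul0r !mul1r subr0 add0r.
by rewrite cosB hc hs -!expr2 cos2Dsin2.
Qed.

Lemma eqang_sym a b : eqang a b -> eqang b a.
Proof. by move=> /eqangE[? ?]; exact/eqangE. Qed.

Lemma eqang_trans b a c : eqang a b -> eqang b c -> eqang a c.
Proof. by move=> /eqangE[h1 h2] /eqangE[h3 h4]; apply/eqangE; rewrite h1 h2. Qed.

Lemma eqangD a b x y : eqang a b -> eqang x y -> eqang (a + x) (b + y).
Proof.
by move=> /eqangE[h1 h2] /eqangE[h3 h4]; apply/eqangE; rewrite !cosD !sinD h1 h2 h3 h4.
Qed.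

Lemma eqangN a b : eqang a b -> eqang (- a) (- b).
Proof. by move=> /eqangE[h1 h2]; apply/eqangE; rewrite !cosN !sinN h1 h2. Qed.

Lemma eqangB a b x y : eqang a b -> eqang x y -> eqang (a - x) (b - y).
Proof. by move=> h1 h2; apply: eqangD => //; exact: eqangN. Qed.

Lemma eqangMn a b n : eqang a b -> eqang (a *+ n) (b *+ n).
Proof.
move=> h; elim: n => [|n IH]; first by rewrite !mulr0n; exact: eqang_refl.
by rewrite !mulrS; exact: eqangD.
Qed.

Lemma eqangMz a b (n : int) : eqang a b -> eqang (n%:~R * a) (n%:~R * b).
Proof.
move=> h; rewrite !mulrzl; case: n => n; first exact: eqangMn.
by rewrite !NegzE !mulrNz; apply: eqangN; exact: eqangMn.
Qed.

Lemma eqang_sum (I : Type) (r : seq I) (F G : I -> R) :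
  (forall i, eqang (F i) (G i)) ->
  eqang (\sum_(i <- r) F i) (\sum_(i <- r) G i).
Proof.
move=> h; elim: r => [|i r IH]; first by rewrite !big_nil; exact: eqang_refl.
by rewrite !big_cons; exact: eqangD.
Qed.

Lemma cos1_small a : `|a| < pi *+ 2 -> cos a = 1 -> a = 0.
Proof.
rewrite -cos_norm => h; set x := `|a|; move: h; rewrite -/x => h c1.
have x0 : 0 <= x by exact: normr_ge0.
apply/eqP; rewrite -normr_eq0 -/x; apply/eqP.
have pi0 := pi_gt0 R.
have zin : (0 : R) \in `[0, pi] by rewrite in_itv /= lexx ltW.
have [xp|xp] := leP x pi.
  by apply: cos_inj => //; rewrite ?in_itv /= ?x0 ?xp ?cos0.
have: pi *+ 2 - x = 0.
  apply: cos_inj => //.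
    by rewrite in_itv /= mulr2n; apply/andP; split; move: h; rewrite mulr2n; lra.
  by rewrite cosB c1 cos2pi sin2pi cos0 mul0r addr0 mulr1.
by move=> /eqP; rewrite subr_eq0 => /eqP e; move: h; rewrite e ltxx.
Qed.

Lemma cos1_int a : cos a = 1 -> exists k : int, a = k%:~R * (pi *+ 2).
Proof.
move=> c1; have p0 : 0 < pi *+ 2 :> R by rewrite pmulrn_lgt0 ?pi_gt0.
exists (Num.floor (a / (pi *+ 2))).
set k := Num.floor _; apply/eqP; rewrite -subr_eq0; apply/eqP/cos1_small.
  have := floor_itv (a / (pi *+ 2)); rewrite -/k => /andP[h1 h2].
  rewrite ler_pdivlMr // in h1; rewrite ltr_pdivrMr // intrD mulrDl mul1r in h2.
  by rewrite ger0_norm ?subr_ge0 // ltrBlDr addrC.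
rewrite -[RHS]c1; have := @eqangMz (pi *+ 2) 0 k.
rewrite mulr0 => /(_ _)/eqangE[|]; first by rewrite /eqang subr0 cos2pi.
by move=> hc hs; rewrite cosB hc hs cos0 sin0 mulr0 mulr1 addr0.
Qed.

Lemma eqang_int a b : eqang a b -> exists k : int, a - b = k%:~R * (pi *+ 2).
Proof. exact: cos1_int. Qed.

(* Half-plane branch of the angle; the cut-off 1/2 makes it continuous everywhere. *)
Definition branch a : R := atan (sin a / Num.max 2^-1 (cos a)).

Lemma branchP a : 2^-1 < cos a -> eqang (branch a) a.
Proof.
move=> h; rewrite /branch max_r ?ltW //.
set t := sin a / cos a.
have c0 : 0 < cos a by lra.
have ct : cos (atan t) = cos a.
  rewrite cos_atan.
  have -> : 1 + t ^+ 2 = (cos a)^-1 ^+ 2.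
    have := cos2Dsin2 a; rewrite /t => e.
    have -> : 1 + (sin a / cos a) ^+ 2 = (cos a ^+ 2 + sin a ^+ 2) * (cos a)^-1 ^+2.
      by field; lra.
    by rewrite e mul1r.
  by rewrite sqrtr_sqr ger0_norm ?invr_ge0 ?ltW // invrK.
apply/eqangE; split => //.
have := atanK t; rewrite /tan ct => e.
by have : sin (atan t) / cos a = sin a / cos a by []; move/divIf; apply; rewrite gt_eqF.
Qed.

(** The image of [K] is an interval. With two distinct values it would contain two at positive
    distance at most 1, too close to be congruent modulo [2 * pi]. *)
Lemma connected_eqang_const (T : topologicalType) (K : set T) (h : T -> R) (x y : T) :
  connected K -> {within K, continuous h} -> (forall z, K z -> eqang (h z) 0) ->
  K x -> K y -> h x = h y.
Proof.
move=> cK ch h0 Kx Ky.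
have /connected_intervalP I : connected (h @` K) by exact: connected_continuous_connected.
have p0 := pi_gt0 R.
wlog lxy : x y Kx Ky / h x <= h y.
  by move=> W; case: (leP (h x) (h y)) => [|/ltW]/W-> //.
apply/eqP; rewrite eq_le lxy /= leNgt; apply/negP => lt.
set m := Num.min (h y) (h x + 1).
have mx : h x < m by rewrite lt_min lt ltrDl ltr01.
have my : m <= h y by rewrite ge_min lexx.
have m1 : m <= h x + 1 by rewrite ge_min lexx orbT.
have [z Kz ez] : (h @` K) m.
  by apply: (I (h x) (h y)); [exists x|exists y|rewrite ltW].
have := eqang_trans (h0 _ Kz) (eqang_sym (h0 _ Kx)); rewrite ez => /cos1_small.
have := pi_ge2 R.
by rewrite gtr0_norm ?subr_gt0 // mulr2n => p2 /(_ _)/eqP; rewrite subr_eq0 gt_eqF //; lra.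
Qed.

End Angles.

(** * Functions continuous modulo [2 * pi] *)

Section CircleContinuity.
Context {R : realType} {T : topologicalType}.
Implicit Types (K : set T) (F G : T -> R).

(* F is continuous on K as a map to R / 2 pi Z. *)
Definition ccont K F := {within K, continuous (fun z => cos (F z))} /\
  {within K, continuous (fun z => sin (F z))}.

Lemma ccont_eqang K F G : (forall z, K z -> eqang (F z) (G z)) ->
  ccont K F -> ccont K G.
Proof.
by move=> e [h1 h2]; split; [apply: (within_eq _ h1)|apply: (within_eq _ h2)] => z /e/eqangE[].
Qed.

Lemma ccont_sub K A F : A `<=` K -> ccont K F -> ccont A F.
Proof. by move=> s [h1 h2]; split; exact: continuous_subspaceW s _. Qed.

Lemma ccont_cont K F : {within K, continuous F} -> ccont K F.
Proof.
by move=> c; split; apply: within_comp => //; [exact: continuous_cos|exact: continuous_sin].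
Qed.

Lemma ccontN K F : ccont K F -> ccont K (fun z => - F z).
Proof.
move=> [h1 h2]; split; first by apply: (within_eq _ h1) => z _; rewrite cosN.
by apply: (within_eq _ (within_opp h2)) => z _; rewrite sinN.
Qed.

Lemma ccontD K F G : ccont K F -> ccont K G -> ccont K (fun z => F z + G z).
Proof.
move=> [h1 h2] [h3 h4]; split.
  apply: (within_eq _ (within_add (within_mul h1 h3) (within_opp (within_mul h2 h4)))) => z _.
  by rewrite cosD.
apply: (within_eq _ (within_add (within_mul h2 h3) (within_mul h1 h4))) => z _.
by rewrite sinD.
Qed.

Lemma ccontB K F G : ccont K F -> ccont K G -> ccont K (fun z => F z - G z).
Proof. by move=> h1 h2; apply: ccontD => //; exact: ccontN. Qed.

Lemma ccont_sum K (I : Type) (r : seq I) (F : I -> T -> R) :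
  (forall i, ccont K (F i)) -> ccont K (fun z => \sum_(i <- r) F i z).
Proof.
move=> cF; elim: r => [|i r IH].
  apply: (ccont_eqang _ (ccont_cont (@within_cst R T K 0))) => z _; rewrite big_nil; exact: eqang_refl.
apply: (ccont_eqang _ (ccontD (cF i) IH)) => z _; rewrite big_cons; exact: eqang_refl.
Qed.

(** Only integer multiples respect congruence modulo [2 * pi], whence the integer coefficients in
    later combinations of angles. *)
Lemma ccontMz K F (n : int) : ccont K F -> ccont K (fun z => n%:~R * F z).
Proof.
move=> cF; suff Hn (m : nat) : ccont K (fun z => m%:R * F z).
  case: n => m; first exact: Hn.
  apply: (ccont_eqang _ (ccontN (Hn m.+1))) => z _.
  by rewrite NegzE mulrNz mulNr; exact: eqang_refl.
elim: m => [|m IH].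
  apply: (ccont_eqang _ (ccont_cont (@within_cst R T K 0))) => z _; rewrite mul0r; exact: eqang_refl.
apply: (ccont_eqang _ (ccontD cF IH)) => z _.
by rewrite -natr1 mulrDl mul1r addrC; exact: eqang_refl.
Qed.

Lemma within_branch K F : ccont K F -> {within K, continuous (fun z => branch (F z))}.
Proof.
move=> [h1 h2].
apply: (within_comp (h := atan)); last exact: continuous_atan.
apply: within_mul => //; apply: within_inv; last exact: within_max.
by move=> z _; rewrite gt_eqF // lt_max invr_gt0 ltr0n.
Qed.

End CircleContinuity.

(** * Angle functions and lifts in the plane *)

Section Plane.
Context {R : realType}.
Implicit Types (z q v w : R * R) (K : set (R * R)).

Lemma nbhs_planeP z (A : set (R * R)) :
  nbhs z A <-> exists e : R, 0 < e /\ forall y, `|y - z| < e -> A y.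
Proof.
rewrite -nbhs_nbhs_norm; split=> [[e e0 h]|[e [e0 h]]]; exists e => //.
  by split=> // y yz; apply: h; rewrite /ball_/= distrC.
by move=> y /= yz; apply: h; rewrite distrC.
Qed.

Lemma plane_norm1 z : `|z.1| <= `|z|.
Proof. by rewrite prod_normE le_max lexx. Qed.

Lemma plane_norm2 z : `|z.2| <= `|z|.
Proof. by rewrite prod_normE le_max lexx orbT. Qed.

Lemma plane_norm_le z (M : R) : `|z.1| <= M -> `|z.2| <= M -> `|z| <= M.
Proof. by move=> h1 h2; rewrite prod_normE ge_max h1. Qed.

Lemma compact_box (M : R) : compact [set z : R * R | `|z| <= M].
Proof.
have -> : [set z : R * R | `|z| <= M] = `[- M, M]%classic `*` `[- M, M]%classic.
  apply/seteqP; split=> z /=; rewrite !in_itv /= -!ler_norml.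
    by move=> h; split; apply: le_trans h; [exact: plane_norm1|exact: plane_norm2].
  by move=> [h1 h2]; exact: plane_norm_le.
by apply: compact_setX; exact: segment_compact.
Qed.

Lemma closed_far K q : closed K -> ~ K q ->
  exists e : R, 0 < e /\ forall z, K z -> e <= `|z - q|.
Proof.
move=> cK nK; have /nbhs_planeP[e [e0 h]] : nbhs q (~` K).
  by apply: open_nbhs_nbhs; split => //; exact: closed_openC.
by exists e; split => // z Kz; rewrite leNgt; apply/negP => /h.
Qed.

(** Uniform continuity on a box, from the near-covering form of compactness. *)
Lemma ccont_uniform (F : R * R -> R) (M : R) : ccont setT F ->
  exists e : R, 0 < e /\ forall z y, `|z| <= M -> `|y - z| < e ->
    2^-1 < cos (F y - F z).
Proof.
move=> [cc cs].
have /compact_near_coveringP/(_ R 0^'+ (fun e z => forall y, `|y - z| < e -> 2^-1 < cos (F y - F z))) :=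
  @compact_box M.
case.
- move=> z0 _.
  have hc : \forall y \near z0, `|cos (F z0) - cos (F y)| < 8^-1.
    have /(_ z0)/cvgrPdist_lt : continuous (fun z => cos (F z)) by exact: within_setT.
    by apply; rewrite invr_gt0.
  have hs : \forall y \near z0, `|sin (F z0) - sin (F y)| < 8^-1.
    have /(_ z0)/cvgrPdist_lt : continuous (fun z => sin (F z)) by exact: within_setT.
    by apply; rewrite invr_gt0.
  have /nbhs_planeP[e [e0 he]] : nbhs z0 [set y |
      `|cos (F z0) - cos (F y)| < 8^-1 /\ `|sin (F z0) - sin (F y)| < 8^-1].
    exact: filterI hc hs.
  exists ([set z | `|z - z0| < e / 2], [set t | t < e / 2]).
    split => /=; last by apply: nbhs_right_lt; rewrite divr_gt0.
    by apply/nbhs_planeP; exists (e / 2); split; [rewrite divr_gt0|].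
  move=> [z t] /= [hz ht] y hy.
  have [c1 s1] : (`|cos (F z0) - cos (F z)| < 8^-1) /\ (`|sin (F z0) - sin (F z)| < 8^-1).
    by apply: he; lra.
  have [c2 s2] : (`|cos (F z0) - cos (F y)| < 8^-1) /\ (`|sin (F z0) - sin (F y)| < 8^-1).
    apply: he; rewrite -(subrK z y) -addrA; apply: le_lt_trans (ler_normD _ _) _; lra.
  have h1 := cos2Dsin2 (F y); have h2 := cos2Dsin2 (F z).
  rewrite cosB; move: c1 s1 c2 s2; rewrite !ltr_norml.
  move: (cos (F z0)) (sin (F z0)) (cos (F z)) (sin (F z)) (cos (F y)) (sin (F y)) h1 h2.
  move=> c s cz sz cy sy h1 h2 /andP[? ?] /andP[? ?] /andP[? ?] /andP[? ?].
  (* This squared chord equals [2 - 2 * cos (F y - F z)], so the bound [8^-1] keeps the cosine above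
     [2^-1]. *)
  have : (cy - cz) ^+ 2 + (sy - sz) ^+ 2 <= 8^-1.
    have sq (d : R) : - 4^-1 < d -> d < 4^-1 -> d ^+ 2 <= 16^-1 by move=> ? ?; nra.
    have : (cy - cz) ^+ 2 <= 16^-1 by apply: sq; lra.
    have : (sy - sz) ^+ 2 <= 16^-1 by apply: sq; lra.
    lra.
  lra.
- move=> e /= e0 he; exists (e / 2); split; first by rewrite divr_gt0.
  move=> z y hz hy.
  apply: (he (e / 2)) => //=; last by rewrite divr_gt0.
  by rewrite sub0r normrN gtr0_norm ?divr_gt0 // ltr_pdivrMr // mulr_natr mulr2n ltrDl.
Qed.

(* The lift is F 0 plus the sum of the small angle increments along the segment
   from 0 to z. *)
Lemma ccont_lift (F : R * R -> R) (M : R) : ccont setT F ->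
  exists Psi : R * R -> R, continuous Psi /\
    forall z, `|z| <= M -> eqang (Psi z) (F z).
Proof.
move=> cF; have [e [e0 he]] := ccont_uniform M cF.
have [N hN] : exists N : nat, `|M| / N.+1%:R < e.
  have lt0 : 0 < e / (`|M| + 1) by rewrite divr_gt0 // ltr_wpDl.
  have [N hN] := ltr_add_invr lt0.
  exists N; rewrite add0r in hN.
  have : N.+1%:R^-1 * (`|M| + 1) < e by rewrite -ltr_pdivlMr // ltr_wpDl.
  apply: le_lt_trans; rewrite mulrC ler_wpM2l ?lerDl //.
pose pt (k : nat) z : R * R := (k%:R / N.+1%:R : R) *: z.
pose Psi z := F 0 + \sum_(k <- iota 0 N.+1) branch (F (pt k.+1 z) - F (pt k z)).
have cpt k : ccont setT (fun z => F (pt k z)).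
  have cp : continuous (pt k) by move=> z; apply: cvgZl_tmp; exact: cvg_id.
  case: cF => /within_setT c1 /within_setT c2.
  split; apply: continuous_subspaceT => z.
    by apply: (@continuous_comp _ _ _ (pt k) (fun y => cos (F y))); [exact: cp|exact: c1].
  by apply: (@continuous_comp _ _ _ (pt k) (fun y => sin (F y))); [exact: cp|exact: c2].
exists Psi; split.
  apply: within_setT; apply: within_add; first exact: within_cst.
  by apply: within_sum => k; apply: within_branch; apply: ccontB.
move=> z hz.
have step k : (k <= N.+1)%N ->
    eqang (F 0 + \sum_(i <- iota 0 k) branch (F (pt i.+1 z) - F (pt i z))) (F (pt k z)).
  elim: k => [|k IH] hk.
    by rewrite big_nil addr0 /pt mul0r scale0r; exact: eqang_refl.
  rewrite -addn1 iotaD big_cat /= add0n big_seq1 addn1 addrA.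
  apply: eqang_trans (eqangD (IH (ltnW hk)) (branchP _)) _; last first.
    by rewrite addrC subrK; exact: eqang_refl.
  apply: he.
    rewrite /pt prod_norm_scale ger0_norm ?divr_ge0 // -[leRHS]mul1r.
    apply: ler_pM => //.
    by rewrite ler_pdivrMr // mul1r ler_nat ltnW.
  rewrite /pt -scalerBl prod_norm_scale -mulrBl -natrB // subSnn mul1r.
  rewrite ger0_norm ?invr_ge0 // mulrC; apply: le_lt_trans hN.
  by rewrite ler_wpM2r ?invr_ge0 //; apply: le_trans hz (ler_norm _).
apply: eqang_trans (step N.+1 (leqnn _)) _.
by rewrite /pt divff ?pnatr_eq0 // scale1r; exact: eqang_refl.
Qed.

(** The Euclidean norm, as opposed to the maximum norm that [R * R] carries. *)
Definition enorm z : R := Num.sqrt (z.1 ^+ 2 + z.2 ^+ 2).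

(** The principal argument. It jumps across the negative first axis, but its cosine and sine are
    continuous away from 0. *)
Definition ang z : R :=
  if 0 <= z.2 then acos (z.1 / enorm z) else - acos (z.1 / enorm z).

Lemma enorm_sqr z : enorm z ^+ 2 = z.1 ^+ 2 + z.2 ^+ 2.
Proof. by rewrite sqr_sqrtr // addr_ge0 // sqr_ge0. Qed.

Lemma enorm_gt0 z : z != 0 -> 0 < enorm z.
Proof.
move=> z0; rewrite sqrtr_gt0 lt_neqAle addr_ge0 ?sqr_ge0 // andbT eq_sym.
rewrite paddr_eq0 ?sqr_ge0 // !sqrf_eq0; apply: contra z0 => /andP[/eqP h1 /eqP h2].
by case: z h1 h2 => a b /= -> ->.
Qed.

Lemma angE z : z != 0 -> cos (ang z) = z.1 / enorm z /\ sin (ang z) = z.2 / enorm z.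
Proof.
move=> z0; have e0 := enorm_gt0 z0; have e2 := enorm_sqr z.
set x := z.1 / enorm z; set y := z.2 / enorm z.
have xy : x ^+ 2 + y ^+ 2 = 1.
  by rewrite /x /y !expr_div_n -mulrDl -e2 divff // sqrf_eq0 gt_eqF.
have xb : -1 <= x <= 1 by apply/andP; split; nra.
have sE : sin (acos x) = `|y|.
  by rewrite sin_acos // -sqrtr_sqr; congr Num.sqrt; lra.
have cE : cos (acos x) = x by apply: acosK; rewrite in_itv.
rewrite /ang -/x; case: ifPn => h; rewrite ?cosN ?sinN cE sE; split => //.
  by rewrite ger0_norm // divr_ge0 // ltW.
by rewrite ltr0_norm ?opprK // pmulr_llt0 ?invr_gt0 // ltNge.
Qed.

(** If the cosine were at most [2^-1], the law of cosines would make the squared Euclidean length of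
    [w - v] at least half that of [v]; comparison with the maximum norm shows that it is less. *)
Lemma ang_close v w : 2 * `|w - v| < `|v| -> 2^-1 < cos (ang w - ang v).
Proof.
move=> h.
have v0 : v != 0.
  by apply: contraTneq h => ->; rewrite normr0 -leNgt mulr_ge0.
have w0 : w != 0.
  by apply: contraTneq h => ->; rewrite sub0r normrN -leNgt ler_peMl // ler1n.
have [cv sv] := angE v0; have [cw sw] := angE w0.
have nv := enorm_gt0 v0; have nw := enorm_gt0 w0.
have nv2 := enorm_sqr v; have nw2 := enorm_sqr w.
rewrite ltNge; apply/negP => hc.
have dotE : v.1 * w.1 + v.2 * w.2 = enorm v * enorm w * cos (ang w - ang v).
  rewrite cosB cv sv cw sw; field; by rewrite !gt_eqF.
have h1 : v.1 * w.1 + v.2 * w.2 <= (enorm v ^+ 2 + enorm w ^+ 2) / 4.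
  have p : 0 < enorm v * enorm w by exact: mulr_gt0.
  rewrite dotE; apply: le_trans (_ : enorm v * enorm w / 2 <= _).
    by rewrite ler_wpM2l // ltW.
  have := sqr_ge0 (enorm v - enorm w); lra.
have : `|v| ^+ 2 <= v.1 ^+ 2 + v.2 ^+ 2.
  have [->|->] : `|v| = `|v.1| \/ `|v| = `|v.2|.
    by rewrite prod_normE /Order.max; case: ifP; auto.
  - by rewrite real_normK ?num_real // lerDl sqr_ge0.
  - by rewrite real_normK ?num_real // lerDr sqr_ge0.
have : (w.1 - v.1) ^+ 2 <= `|w - v| ^+ 2.
  by rewrite -[leLHS]real_normK ?num_real // lerXn2r ?nnegrE // (plane_norm1 (w - v)).
have : (w.2 - v.2) ^+ 2 <= `|w - v| ^+ 2.
  by rewrite -[leLHS]real_normK ?num_real // lerXn2r ?nnegrE // (plane_norm2 (w - v)).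
have : 4 * `|w - v| ^+ 2 < `|v| ^+ 2.
  have -> : 4 * `|w - v| ^+ 2 = (2 * `|w - v|) ^+ 2 by ring.
  by rewrite ltrXn2r // ?nnegrE // mulr_ge0.
nra.
Qed.

Definition arg q z : R := ang (z - q).

Lemma ccont_arg K q : ~ K q -> ccont K (arg q).
Proof.
move=> nK.
have d0 z : K z -> z - q != 0.
  by move=> Kz; rewrite subr_eq0; apply: contra_notN nK => /eqP <-.
have c1 : {within K, continuous (fun z : R * R => (z - q).1)}.
  apply: continuous_subspaceT => z; apply: cvgB; last exact: cvg_cst.
  exact: cvg_fst.
have c2 : {within K, continuous (fun z : R * R => (z - q).2)}.
  apply: continuous_subspaceT => z; apply: cvgB; last exact: cvg_cst.
  exact: cvg_snd.
have cn : {within K, continuous (fun z => enorm (z - q))}.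
  apply: (within_comp (h := Num.sqrt)); last exact: sqrt_continuous.
  apply: within_add.
    by apply: (within_eq _ (within_mul c1 c1)) => z _; rewrite expr2.
  by apply: (within_eq _ (within_mul c2 c2)) => z _; rewrite expr2.
have cV : {within K, continuous (fun z => (enorm (z - q))^-1)}.
  by apply: within_inv => // z /d0/enorm_gt0; rewrite lt0r => /andP[].
split.
  by apply: (within_eq _ (within_mul c1 cV)) => z /d0/angE[-> _].
by apply: (within_eq _ (within_mul c2 cV)) => z /d0/angE[_ ->].
Qed.

End Plane.

(** * Bounded complementary components *)

Lemma ccontU {R : realType} (A B : set (R * R)) (F : R * R -> R) :
  closed A -> closed B -> ccont A F -> ccont B F -> ccont (A `|` B) F.
Proof. by move=> cA cB [h1 h2] [h3 h4]; split; apply: withinU_continuous. Qed.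

Section Components.
Context {R : realType}.
Implicit Types (z q : R * R) (K U : set (R * R)).

Lemma box_connected z (e : R) : connected [set y : R * R | `|y - z| < e].
Proof.
have [e0|e0] := leP e 0.
  rewrite (_ : [set _ | _] = set0); first exact: connected0.
  apply/seteqP; split => // y /= h.
  by have := le_lt_trans (normr_ge0 _) h; rewrite ltNge e0.
pose seg y := (fun t : R => z + t *: (y - z)) @` `[0, 1]%classic.
have -> : [set y : R * R | `|y - z| < e] = \bigcup_(y in [set y | `|y - z| < e]) seg y.
  apply/seteqP; split => [y /= h|y /= [w /= hw [t /=]]].
    exists y => //; exists 1; first by rewrite /= in_itv /= ler01 lexx.
    by rewrite scale1r addrC subrK.
  rewrite in_itv /= => /andP[t0 t1] <-.
  rewrite addrC addKr prod_norm_scale ger0_norm //.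
  by apply: le_lt_trans hw; rewrite ler_piMl.
apply: bigcup_connected.
  by exists z => w /= _; exists 0; rewrite ?scale0r ?addr0 //= in_itv /= lexx ler01.
move=> w _; apply: connected_continuous_connected; first exact: segment_connected.
apply: continuous_subspaceT => t; apply: cvgD; first exact: cvg_cst.
by apply: cvgZr_tmp; exact: cvg_id.
Qed.

(** A ball around [z] that misses [K] is connected, so it lies wholly inside or wholly outside the
    component. *)
Lemma component_nbhs K q z : closed K -> ~ K z ->
  (connected_component (~` K) q z -> nbhs z (connected_component (~` K) q)) /\
  (~ connected_component (~` K) q z -> nbhs z (~` connected_component (~` K) q)).
Proof.
move=> cK nK; have [e [e0 he]] := closed_far cK nK.
set B := [set y : R * R | `|y - z| < e].
have Bz : B z by rewrite /B /= subrr normr0.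
have BK : B `<=` ~` K by move=> y /= h Ky; have := he _ Ky; rewrite leNgt h.
have BC : B `<=` connected_component (~` K) z.
  by apply: connected_component_max => //; exact: box_connected.
split=> h; apply/nbhs_planeP; exists e; split => // y hy.
  by rewrite (same_connected_component h); exact: BC.
move=> hq; apply: h; apply: connected_component_trans hq _.
by apply: connected_component_sym; exact: BC.
Qed.

(** Together with [component_setC_closed], this provides the two closed pieces glued in
    [bounded_component_degree]. *)
Lemma component_setU_closed K q : closed K ->
  closed (connected_component (~` K) q `|` K).
Proof.
move=> cK; rewrite -[X in closed X]setCK; apply: open_closedC.
rewrite openE => z /= h; have nK : ~ K z by move=> Kz; apply: h; right.
have /nbhs_planeP[e [e0 he]] : nbhs z (~` connected_component (~` K) q).
  by apply: (component_nbhs q cK nK).2 => U; apply: h; left.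
have [e' [e'0 he']] := closed_far cK nK.
apply/nbhs_planeP; exists (Num.min e e'); split; first by rewrite lt_min e0.
move=> y; rewrite lt_min => /andP[h1 h2] [/(he _ h1)//|Ky].
by have := he' _ Ky; rewrite leNgt h2.
Qed.

Lemma component_setC_closed K q : closed K ->
  closed (~` connected_component (~` K) q).
Proof.
move=> cK; apply: open_closedC; rewrite openE => z /= h.
by apply: (component_nbhs q cK _).1 => //; exact: connected_component_sub h.
Qed.

Lemma arg_circle q (r t : R) : 0 < r ->
  eqang (arg q (q + r *: (cos t, sin t))) t.
Proof.
move=> r0; set v : R * R := r *: (cos t, sin t).
have en : enorm v = r.
  by rewrite /enorm /= !exprMn -mulrDr cos2Dsin2 mulr1 sqrtr_sqr ger0_norm // ltW.
have v0 : v != 0.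
  by apply: contraTneq r0 => e; rewrite -en e /enorm /= expr0n /= addr0 sqrtr0 ltxx.
rewrite /arg addrC addKr; have [h1 h2] := angE v0; apply/eqangE.
by rewrite h1 h2 en /= mulrAC divff ?gt_eqF // mul1r mulrAC divff ?gt_eqF // mul1r.
Qed.

(* Otherwise [Phi - H] on the component of [q], glued to [n * arg q] outside it,
   would extend the degree [n] map of a large circle to the disc. *)
Lemma bounded_component_degree K q (n : int) (H Phi : R * R -> R) :
  closed K -> ~ K q -> bounded2 (connected_component (~` K) q) ->
  ccont (connected_component (~` K) q `|` K) H -> continuous Phi ->
  (forall z, K z -> eqang (Phi z) (n%:~R * arg q z + H z)) -> n = 0.
Proof.
set U := connected_component _ _ => cK nK [M bU] cH cPhi e.
have Uq : U q by exact: connected_component_refl.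
have M0 : 0 <= M by have [h _] := bU _ Uq; apply: le_trans h.
pose G z := if `[<U z>] then Phi z - H z else n%:~R * arg q z.
have GT : ccont setT G.
  rewrite (_ : setT = (U `|` K) `|` ~` U); last first.
    by apply/seteqP; split => // z _; case: (pselect (U z)); [left; left|right].
  apply: ccontU; [exact: component_setU_closed|exact: component_setC_closed| |].
    apply: (ccont_eqang _ (ccontB (ccont_cont (continuous_subspaceT cPhi)) cH)) => z UK.
    rewrite /G; case: asboolP => [_|nU]; first exact: eqang_refl.
    have Kz : K z by case: UK.
    have -> : n%:~R * arg q z = n%:~R * arg q z + H z - H z by rewrite addrK.
    by apply: eqangB; [exact: e|exact: eqang_refl].
  have cA : ccont (~` U) (arg q) by apply: ccont_arg => /(_ Uq).
  apply: (ccont_eqang _ (ccontMz n cA)) => z nU.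
  by rewrite /G; case: asboolP => // _; exact: eqang_refl.
(* On the component of [q] both coordinates differ from those of [q] by at most [M + |q|], less than
   half of [r]; so the circle of radius [r] about [q] avoids it. *)
pose r := 2 * (M + `|q| + 1).
have r0 : 0 < r by rewrite mulr_gt0 // ltr_wpDl // addr_ge0.
have [Psi [cPsi ePsi]] := ccont_lift (`|q| + r) GT.
pose p t : R * R := q + r *: (cos t, sin t).
have pU t : ~ U (p t).
  move=> /bU /= [h1 h2].
  have B1 : `|cos t| < 2^-1.
    have : `|r * cos t| <= M + `|q|.
      have -> : r * cos t = (p t).1 - q.1 by rewrite /p /= addrC addKr.
      apply: le_trans (ler_normB _ _) _; apply: lerD => //; exact: plane_norm1.
    rewrite normrM (gtr0_norm r0) /r => hh; rewrite -(ltr_pM2l r0) /r; lra.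
  have B2 : `|sin t| < 2^-1.
    have : `|r * sin t| <= M + `|q|.
      have -> : r * sin t = (p t).2 - q.2 by rewrite /p /= addrC addKr.
      apply: le_trans (ler_normB _ _) _; apply: lerD => //; exact: plane_norm2.
    rewrite normrM (gtr0_norm r0) /r => hh; rewrite -(ltr_pM2l r0) /r; lra.
  have := cos2Dsin2 t; move: B1 B2; rewrite !ltr_norml => /andP[? ?] /andP[? ?].
  have : cos t ^+ 2 < 2^-1 by nra.
  have : sin t ^+ 2 < 2^-1 by nra.
  lra.
have pn t : `|p t| <= `|q| + r.
  apply: le_trans (ler_normD _ _) _; rewrite lerD2l.
  by apply: plane_norm_le => /=;
    rewrite normrM (gtr0_norm r0) ler_piMr ?cos_max ?sin_max // ltW.
have cp : continuous p.
  move=> t; apply: cvgD; first exact: cvg_cst.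
  have h : ((cos x, sin x) : R * R) @[x --> t] --> ((cos t, sin t) : R * R).
    exact: (cvg_pair (@continuous_cos R t) (@continuous_sin R t)).
  exact: (cvgZl_tmp (k := r) h).
(* A continuous multiple of [2 * pi], hence constant; a full turn then gives [n * (2 * pi) = 0]. *)
pose g t := Psi (p t) - n%:~R * t.
have pi0 := pi_gt0 R.
have : g 0 = g (pi *+ 2).
  apply: (@connected_eqang_const R _ `[0, pi *+ 2]%classic).
  - exact: segment_connected.
  - apply: continuous_subspaceT => t; apply: cvgB; first exact: (cvg_comp p Psi (cp t) (cPsi _)).
    by apply: cvgMr; exact: cvg_id.
  - move=> t _; rewrite /g -[X in eqang _ X](subrr (n%:~R * t)); apply: eqangB; last exact: eqang_refl.
    apply: eqang_trans (ePsi _ (pn t)) _; rewrite /G; case: asboolP => [/pU//|_].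
    by apply: eqangMz; exact: arg_circle.
  - by rewrite /= in_itv /= lexx mulrn_wge0 // ltW.
  - by rewrite /= in_itv /= lexx mulrn_wge0 // ltW.
rewrite /g /p cos2pi sin2pi cos0 sin0 mulr0 => /addrI/oppr_inj/esym/eqP.
by rewrite mulf_eq0 mulrn_eq0 /= (gt_eqF pi0) orbF intr_eq0 => /eqP.
Qed.

End Components.

(** * Continuous logarithms on compact sets *)

Section Logarithms.
Context {R : realType}.
Implicit Types (F Phi : R * R -> R) (K : set (R * R)).

(** A continuous real branch on [K] of the angle [F], that is, a logarithm of the circle-valued map
    with angle [F]. *)
Definition islog K F Phi :=
  {within K, continuous Phi} /\ forall z, K z -> eqang (Phi z) (F z).

Lemma continuous_comp_within (T S U : topologicalType) (f : T -> S) (g : S -> U)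
    (K : set S) : continuous f -> (forall x, K (f x)) -> {within K, continuous g} ->
  continuous (g \o f).
Proof.
move=> cf fK cg; have {}cg := (@subspace_continuousP _ K _ g).1 cg.
move=> x A /= /(cg _ (fK x)) h.
have := cf x _ h; rewrite /nbhs /=.
by apply: filterS => y /=; apply; exact: fK.
Qed.

(** The plane is mapped onto the arc through its first coordinate, clamped to [[0, 1]], so that
    [ccont_lift] applies; the inverse of [g] carries the lift back to the arc. *)
Lemma arc_log (g : R -> R * R) F :
  {within `[(0 : R), 1], continuous g} ->
  (forall s t, s \in `[0, 1] -> t \in `[0, 1] -> g s = g t -> s = t) ->
  ccont (g @` [set t | t \in `[0, 1]]) F ->
  exists Phi, islog (g @` [set t | t \in `[0, 1]]) F Phi.
Proof.
move=> cg ig [cc cs]; set K := g @` _ in cc cs *.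
pose c (t : R) := Num.max 0 (Num.min t 1).
have cI t : c t \in `[0, 1].
  by rewrite in_itv /= le_max lexx /= ge_max ler01 /= ge_min lexx orbT.
have cid t : t \in `[0, 1] -> c t = t.
  by rewrite in_itv /= => /andP[h1 h2]; rewrite /c min_l // max_r.
have cc' : continuous c.
  apply: within_setT; apply: within_max; apply: continuous_subspaceT => t.
  by apply: continuous_min; [exact: cvg_id|exact: cvg_cst].
have cgc : continuous (g \o c) by apply: (continuous_comp_within cc' _ cg) => t; exact: cI.
pose p (z : R * R) := (g \o c) z.1.
have cp : continuous p.
  by move=> z; apply: (@continuous_comp _ _ _ fst (g \o c)); [exact: cvg_fst|exact: cgc].
have pK z : K (p z) by exists (c z.1) => //; exact: cI.
have cF : ccont setT (fun z => F (p z)).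
  split; apply: continuous_subspaceT.
    exact: (continuous_comp_within cp pK cc).
  exact: (continuous_comp_within cp pK cs).
have [Psi [cPsi ePsi]] := ccont_lift 1 cF.
pose psi (t : R) := Psi (t, 0).
have cpsi : continuous psi.
  move=> t; apply: (@continuous_comp _ _ _ (fun t : R => (t, 0 : R)) Psi); last exact: cPsi.
  have ci : x @[x --> t] --> t by exact: cvg_id.
  have c0 : (0 : R) @[x --> t] --> (0 : R) by exact: cvg_cst.
  exact: (cvg_pair ci c0).
have epsi t : t \in `[0, 1] -> eqang (psi t) (F (g t)).
  move=> tI; rewrite -{2}(cid _ tI); apply: (ePsi (t, 0)).
  apply: plane_norm_le => /=; last by rewrite normr0.
  by move: tI; rewrite in_itv /= => /andP[h1 h2]; rewrite ger0_norm.
pose inv z := xget 0 [set t | t \in `[0, 1] /\ g t = z].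
have invg t : t \in `[0, 1] -> inv (g t) = t.
  move=> tI; rewrite /inv; case: xgetP => [s -> [sI e]|/(_ t)]; first exact: ig.
  by case; split.
exists (fun z => psi (inv z)); split; last by move=> _ [t tI <-]; rewrite invg //; exact: epsi.
apply/withinP => _ [t0 t0I <-]; rewrite invg //.
apply/cvgrPdist_lt => e e0.
(* The parameters where [psi] is at least [e] away from [psi t0] form a compact set; its image is
   closed and misses [g t0], which gives continuity at [g t0]. *)
pose C := [set t | t \in `[0, 1]] `&` (fun t => `|psi t0 - psi t|) @^-1` [set x | e <= x].
have C1 : compact C.
  apply: compact_closedI; first exact: (@segment_compact R 0 1).
  apply: preimage_closed; last exact: closed_ge.
  move=> t _; apply: cvg_norm; apply: cvgB; [exact: cvg_cst|exact: cpsi].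
have C2 : compact (g @` C).
  apply: continuous_compact C1; apply: continuous_subspaceW cg => t [] //.
have C3 : closed (g @` C) by apply: compact_closed C2; exact: norm_hausdorff.
have nC : ~ (g @` C) (g t0).
  move=> [t [tI /= h] e']; move: h; rewrite (ig _ _ tI t0I e') subrr normr0.
  by rewrite leNgt e0.
have : nbhs (g t0) (~` (g @` C)).
  by apply: open_nbhs_nbhs; split => //; exact: closed_openC.
rewrite /within /= /nbhs /= /within /=; apply: filterS => z h [t tI e1]; subst z.
rewrite invg // ltNge; apply/negP => h'; apply: h; exists t => //.
Qed.

Definition logof K F : R * R -> R := xget (fun=> 0) [set Phi | islog K F Phi].

Lemma logofP K F : (exists Phi, islog K F Phi) -> islog K F (logof K F).
Proof. exact: xgetPex. Qed.

(** Two branches differ by a continuous multiple of [2 * pi], which is constant on a connected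
    set. *)
Lemma islog_diff K F Phi Phi' x y : connected K -> islog K F Phi -> islog K F Phi' ->
  K x -> K y -> Phi x - Phi y = Phi' x - Phi' y.
Proof.
move=> cK [c1 e1] [c2 e2] Kx Ky.
have h : Phi x - Phi' x = Phi y - Phi' y.
  apply: (connected_eqang_const cK (within_add c1 (within_opp c2))) => // z Kz.
  by rewrite -[X in eqang _ X](subrr (F z)); apply: eqangB; [exact: e1|exact: e2].
lra.
Qed.

Lemma seq_union_cons (I : eqType) (i : I) (r : seq I) (A : I -> set (R * R)) :
  [set z | exists2 j, j \in i :: r & A j z] =
  A i `|` [set z | exists2 j, j \in r & A j z].
Proof.
apply/seteqP; split => z.
  move=> [j]; rewrite inE => /orP[/eqP ->|jr] Az; first by left.
  by right; exists j.
move=> [Az|[j jr Az]]; first by exists i => //; rewrite mem_head.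
by exists j => //; rewrite inE jr orbT.
Qed.

Lemma within_seq_union (I : eqType) (r : seq I) (A : I -> set (R * R)) Phi :
  (forall i, i \in r -> closed (A i) /\ {within A i, continuous Phi}) ->
  closed [set z | exists2 i, i \in r & A i z] /\
  {within [set z | exists2 i, i \in r & A i z], continuous Phi}.
Proof.
elim: r => [|i r IH] h.
  rewrite (_ : [set _ | _] = set0); first by split; [exact: closed0|exact: continuous_subspace0].
  by apply/seteqP; split => // z [].
rewrite seq_union_cons.
have [h1 h2] := h i (mem_head _ _).
have [|h3 h4] := IH; first by move=> j jr; apply: h; rewrite inE jr orbT.
by split; [exact: closedU|exact: withinU_continuous].
Qed.

Lemma compact_seq_union (I : eqType) (r : seq I) (A : I -> set (R * R)) :
  (forall i, i \in r -> compact (A i)) -> compact [set z | exists2 i, i \in r & A i z].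
Proof.
elim: r => [|i r IH] h.
  rewrite (_ : [set _ | _] = set0); first exact: compact0.
  by apply/seteqP; split => // z [].
rewrite seq_union_cons.
apply: compactU; first by apply: h; rewrite mem_head.
by apply: IH => j jr; apply: h; rewrite inE jr orbT.
Qed.

(** Tietze extension; compactness supplies the closedness and the bound that it requires. *)
Lemma compact_extend K Phi : compact K -> {within K, continuous Phi} ->
  exists Phi', continuous Phi' /\ forall z, K z -> Phi' z = Phi z.
Proof.
move=> cK cPhi.
have [M [_ hM]] : bounded_set (Phi @` K) by apply: compact_bounded; exact: continuous_compact.
have clK : closed K by apply: compact_closed cK; exact: norm_hausdorff.
have M0 : 0 < `|M| + 1 by rewrite ltr_wpDl.
have [|g [h1 h2 _]] := @continuous_bounded_extension _ R pseudometric_normal K clK Phi _ M0 cPhi.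
  move=> z Kz; apply: (hM (`|M| + 1)); last by exists z.
  by rewrite (le_lt_trans (ler_norm _)) // ltrDl.
by exists g; split => // z Kz; rewrite h1 // inE.
Qed.

End Logarithms.

(** * Turning along the edges of a plane graph *)

Section Walks.
Context {R : realType} {V : eqType}.
Variable adj : V -> V -> Prop.
Implicit Types (d : V -> V -> R) (x y : V) (s t : seq V).

Fixpoint wsum d x s : R := if s is y :: s' then d x y + wsum d y s' else 0.

Lemma wsum_cat d x s t : wsum d x (s ++ t) = wsum d x s + wsum d (last x s) t.
Proof. by elim: s x => [|y s IH] x /=; rewrite ?add0r // IH addrA. Qed.

Lemma wsum_edges d x s : wsum d x s = \sum_(e <- zip (x :: s) s) d e.1 e.2.
Proof. by elim: s x => [|y s IH] x /=; rewrite ?big_nil // big_cons IH. Qed.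

Lemma chain_cat x s t : chain adj x (s ++ t) <-> chain adj x s /\ chain adj (last x s) t.
Proof.
elim: s x => [|y s IH] x /=; first by split=> [|[]].
by rewrite IH; split=> [[? []]|[[]]].
Qed.

Lemma chain_zip x s e : chain adj x s -> e \in zip (x :: s) s -> adj e.1 e.2.
Proof.
elim: s x => [|y s IH] x //= [h c]; rewrite inE => /orP[/eqP -> //|].
exact: IH.
Qed.

Lemma zip_mem x s (e : V * V) : e \in zip (x :: s) s -> e.1 \in x :: s /\ e.2 \in x :: s.
Proof.
elim: s x => [|y s IH] x //=; rewrite inE => /orP[/eqP -> /=|/IH[h1 h2]].
  by rewrite !inE !eqxx orbT.
by rewrite !(in_cons x) h1 h2 !orbT.
Qed.

Lemma mem_zip x s v : s != [::] -> v \in x :: s ->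
  exists e, e \in zip (x :: s) s /\ (v = e.1 \/ v = e.2).
Proof.
elim: s x => [|y s IH] x //= _; rewrite inE => /orP[/eqP ->|].
  by exists (x, y); rewrite inE eqxx; split => //; left.
case: s IH => [|z s] IH vy.
  by exists (x, y); rewrite inE eqxx; split => //; right; move: vy; rewrite inE => /eqP.
have [//|e [h1 h2]] := IH y _ vy.
by exists e; split => //; rewrite inE h1 orbT.
Qed.

Hypothesis adjC : forall u v, adj u v -> adj v u.

(* The walk [x :: s] traversed backwards starts at [last x s] and continues
   along [wrev x s]. *)
Fixpoint wrev x s : seq V := if s is y :: s' then rcons (wrev y s') x else [::].

Lemma size_wrev x s : size (wrev x s) = size s.
Proof. by elim: s x => //= y s IH x; rewrite size_rcons IH. Qed.

Lemma last_wrev x s : last (last x s) (wrev x s) = x.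
Proof. by case: s => //= y s; rewrite last_rcons. Qed.

Lemma chain_wrev x s : chain adj x s -> chain adj (last x s) (wrev x s).
Proof.
elim: s x => //= y s IH x [h c]; rewrite -cats1 chain_cat last_wrev /=.
by split; [exact: IH|split => //; exact: adjC].
Qed.

Lemma wsum_wrev d x s : chain adj x s -> (forall u v, adj u v -> d v u = - d u v) ->
  wsum d (last x s) (wrev x s) = - wsum d x s.
Proof.
move=> + da; elim: s x => /= [|y s IH] x; first by rewrite oppr0.
move=> [h c]; rewrite -cats1 wsum_cat last_wrev /= addr0 IH // (da _ _ h).
by rewrite opprD addrC.
Qed.

Lemma chain_mem x s v : v \in x :: s -> chain adj x s ->
  exists s1 s2, [/\ s = s1 ++ s2, last x s1 = v, chain adj x s1 & chain adj v s2].
Proof.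
elim: s x => [|y s IH] x.
  by rewrite inE => /eqP -> _; exists [::], [::].
rewrite inE => /orP[/eqP -> h|vy [h c]]; first by exists [::], (y :: s).
have [s1 [s2 [-> <- c1 c2]]] := IH y vy c.
by exists (y :: s1), s2.
Qed.

End Walks.

Section PlaneGraph.
Context {R : realType} {V : eqType}.
Context {adj : V -> V -> Prop} {pos : V -> R * R} {arc : V -> V -> R -> R * R}.
Hypothesis G : is_plane_graph adj pos arc.
Implicit Types (F Phi : R * R -> R) (u v w : V).

Let adjC u v : adj u v -> adj v u.
Proof. by case: G => [[h _] _ _ _ _]; exact: h. Qed.

Let posI : injective pos.
Proof. by case: G. Qed.

Lemma edge_imgC u v : adj u v -> edge_img arc v u = edge_img arc u v.
Proof. by case: G => [_ _ h _ _] /h[]. Qed.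

Lemma edge_compact u v : adj u v -> compact (edge_img arc u v).
Proof.
case: G => [_ _ h _ _] /h[c _ _ _ _]; apply: continuous_compact; first exact: c.
exact: segment_compact.
Qed.

Lemma edge_closed u v : adj u v -> closed (edge_img arc u v).
Proof. by move=> /edge_compact; apply: compact_closed; exact: norm_hausdorff. Qed.

Lemma edge_connected u v : adj u v -> connected (edge_img arc u v).
Proof.
case: G => [_ _ h _ _] /h[c _ _ _ _]; apply: connected_continuous_connected; last exact: c.
exact: segment_connected.
Qed.

Lemma edge_pos1 u v : adj u v -> edge_img arc u v (pos u).
Proof.
case: G => [_ _ h _ _] /h[_ _ <- _ _]; exists 0 => //=.
by rewrite in_itv /= lexx ler01.
Qed.

Lemma edge_pos2 u v : adj u v -> edge_img arc u v (pos v).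
Proof. by move=> a; rewrite -edge_imgC //; apply/edge_pos1/adjC. Qed.

Lemma edge_pos u v w : adj u v -> edge_img arc u v (pos w) -> w = u \/ w = v.
Proof.
case: G => [_ _ h h' _] a [t]; have [_ _ e0 e1 _] := h _ _ a.
rewrite /= in_itv /= => /andP[t0 t1].
have [t0'|t0'] := eqVneq t 0; first by rewrite t0' e0 => /posI; left.
have [t1'|t1'] := eqVneq t 1; first by rewrite t1' e1 => /posI; right.
by move=> /h'; case => //; rewrite in_itv /= !lt_neqAle eq_sym t0' t1' t0.
Qed.

Lemma edge_islog u v F : adj u v -> ccont (edge_img arc u v) F ->
  islog (edge_img arc u v) F (logof (edge_img arc u v) F).
Proof.
by case: G => [_ _ h _ _] /h[c i _ _ _] cF; apply: logofP; exact: arc_log.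
Qed.

(** The change of a continuous branch of [F] along the edge; by [turn_log] the choice of branch is
    immaterial. The branch depends on the edge only as a set, so reversal just changes the sign. *)
Definition turn F u v : R :=
  logof (edge_img arc u v) F (pos v) - logof (edge_img arc u v) F (pos u).

Lemma turnC F u v : adj u v -> turn F v u = - turn F u v.
Proof. by move=> a; rewrite /turn edge_imgC // opprB. Qed.

Lemma turn_log F Phi u v : adj u v -> islog (edge_img arc u v) F Phi ->
  turn F u v = Phi (pos v) - Phi (pos u).
Proof.
move=> a l; apply: (islog_diff (edge_connected a) _ l (edge_pos2 a) (edge_pos1 a)).
by apply: logofP; exists Phi.
Qed.

Lemma turn_eqang F u v : adj u v -> ccont (edge_img arc u v) F ->
  eqang (turn F u v) (F (pos v) - F (pos u)).
Proof.
move=> a /(edge_islog a)[_ h].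
by apply: eqangB; apply: h; [exact: edge_pos2|exact: edge_pos1].
Qed.

Lemma turn_sum (I : Type) (r : seq I) (n : I -> int) (F : I -> R * R -> R) u v :
  adj u v -> (forall i, ccont (edge_img arc u v) (F i)) ->
  turn (fun z => \sum_(i <- r) (n i)%:~R * F i z) u v =
    \sum_(i <- r) (n i)%:~R * turn (F i) u v.
Proof.
move=> a cF; pose L i := logof (edge_img arc u v) (F i).
have hL i : islog (edge_img arc u v) (F i) (L i) by exact: edge_islog.
rewrite (@turn_log _ (fun z => \sum_(i <- r) (n i)%:~R * L i z)) //.
  by rewrite -sumrB; apply: eq_bigr => i _; rewrite -mulrBr.
split.
  apply: within_sum => i; apply: within_mul; first exact: within_cst.
  by case: (hL i).
by move=> z Kz; apply: eqang_sum => i; apply: eqangMz; apply: (hL i).2.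
Qed.

(** The list [T] admits isolated vertices. *)
Definition subgraph_img (E : seq (V * V)) (T : seq V) : set (R * R) :=
  [set z | exists2 e, e \in E & edge_img arc e.1 e.2 z] `|`
  [set z | exists2 v, v \in T & [set pos v] z].

Lemma subgraph_compact E T : (forall e, e \in E -> adj e.1 e.2) ->
  compact (subgraph_img E T).
Proof.
move=> aE; apply: compactU; apply: compact_seq_union.
  by move=> e /aE; exact: edge_compact.
by move=> v _; exact: compact_set1.
Qed.

Lemma subgraph_closed E T : (forall e, e \in E -> adj e.1 e.2) ->
  closed (subgraph_img E T).
Proof. by move=> /(@subgraph_compact E T); apply: compact_closed; exact: norm_hausdorff. Qed.

(** On each edge take the branch with value [theta] at the first endpoint; the hypothesis on [turn]
    forces [theta] at the other. Distinct edges meet only in vertices, so the branches glue, and the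
    result extends to the plane. *)
Lemma subgraph_log E T F (theta : V -> R) : (forall e, e \in E -> adj e.1 e.2) ->
  ccont (subgraph_img E T) F ->
  (forall v, pos v \in subgraph_img E T -> eqang (theta v) (F (pos v))) ->
  (forall e, e \in E -> turn F e.1 e.2 = theta e.2 - theta e.1) ->
  exists Phi, continuous Phi /\
    forall z, subgraph_img E T z -> eqang (Phi z) (F z).
Proof.
move=> aE cF hth hturn.
have sE e : e \in E -> edge_img arc e.1 e.2 `<=` subgraph_img E T.
  by move=> eE z ez; left; exists e.
pose L (e : V * V) := logof (edge_img arc e.1 e.2) F.
pose phi e z := L e z - L e (pos e.1) + theta e.1.
have hL e : e \in E -> islog (edge_img arc e.1 e.2) F (L e).
  by move=> eE; apply: edge_islog; [exact: aE|exact: ccont_sub (sE _ eE) cF].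
have phiv e v : e \in E -> v = e.1 \/ v = e.2 -> phi e (pos v) = theta v.
  move=> eE [->|->]; first by rewrite /phi subrr add0r.
  by have := hturn _ eE; rewrite /turn /phi -/(L e) => ->; rewrite subrK.
have phiE e z : e \in E -> edge_img arc e.1 e.2 z -> eqang (phi e z) (F z).
  move=> eE ez; have [_ h] := hL _ eE; have p1 := edge_pos1 (aE _ eE).
  rewrite -[X in eqang _ X](subrK (F (pos e.1))); apply: eqangD.
    by apply: eqangB; apply: h.
  by apply: hth; rewrite inE; exact: sE p1.
have compat e e' z : e \in E -> e' \in E -> edge_img arc e.1 e.2 z ->
    edge_img arc e'.1 e'.2 z -> phi e z = phi e' z.
  move=> eE eE' ez ez'.
  (* The same edge with equal or opposite orientation, or two edges meeting only in a vertex. *)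
  have [[|]|ne] := pselect ((e.1 = e'.1 /\ e.2 = e'.2) \/ (e.1 = e'.2 /\ e.2 = e'.1)).
  - by case: e e' {eE eE' ez ez'} => [u v] [u' v'] /= [-> ->].
  - move=> [h1 h2].
    have LE : L e = L e'.
      by rewrite /L; congr (logof _ F); rewrite h1 h2; apply: edge_imgC; exact: aE.
    have := phiv e' e.1 eE' (or_intror h1); rewrite /phi LE; lra.
  - have [_ _ _ _ h5] := G.
    have [w [h1 h2 ->]] := h5 _ _ _ _ _ (aE _ eE) (aE _ eE') ne ez ez'.
    by rewrite !phiv.
pose Phi z := if pselect (exists2 e, e \in E & edge_img arc e.1 e.2 z) is left h
  then phi (projT1 (cid2 h)) z
  else if pselect (exists2 v, v \in T & z = pos v) is left h
  then theta (projT1 (cid2 h)) else 0.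
have PhiE e z : e \in E -> edge_img arc e.1 e.2 z -> Phi z = phi e z.
  move=> eE ez; rewrite /Phi; case: pselect => [h|[]]; last by exists e.
  by case: cid2 => e' /= eE' ez'; exact: compat.
have PhiV v : v \in T -> eqang (Phi (pos v)) (F (pos v)).
  move=> vT; rewrite /Phi; case: pselect => [h|_].
    by case: cid2 => e' /= eE' ez'; exact: phiE.
  case: pselect => [h|[]]; last by exists v.
  case: cid2 => v' /= vT' /posI <-; apply: hth; rewrite inE; right; by exists v.
have [|clE cE] := @within_seq_union _ _ E (fun e => edge_img arc e.1 e.2) Phi.
  move=> e eE; split; first exact: edge_closed (aE _ eE).
  apply: (within_eq (f := phi e)); first by move=> z ez; rewrite (PhiE e).
  apply: within_add; last exact: within_cst.
  by apply: within_add; [exact: (hL _ eE).1|exact: within_cst].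
have [|clT cT] := @within_seq_union _ _ T (fun v => [set pos v]) Phi.
  move=> v _; split; last exact: continuous_subspace1.
  by apply: compact_closed; [exact: norm_hausdorff|exact: compact_set1].
have [Phi' [cPhi' ePhi']] := compact_extend (@subgraph_compact E T aE)
  (withinU_continuous clE clT cE cT).
exists Phi'; split => // z Kz; rewrite ePhi' //.
case: Kz => [[e eE ez]|[v vT ->]]; last exact: PhiV.
by rewrite (PhiE e) //; exact: phiE.
Qed.

End PlaneGraph.

(** * Winding numbers of closed walks *)

(** More rows than columns force a rational relation between the rows; clearing denominators makes
    it integral. *)
Lemma int_relation m n (A : 'I_m -> 'I_n -> int) : (n < m)%N ->
  exists2 c : 'I_m -> int, (exists i, c i != 0) &
    forall j, \sum_i c i * A i j = 0.
Proof.
move=> nm; pose B : 'M[rat]_(m, n) := \matrix_(i, j) (A i j)%:~R.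
have : kermx B != 0.
  rewrite -mxrank_eq0 mxrank_ker subn_eq0 -ltnNge.
  by apply: leq_ltn_trans nm; exact: rank_leq_col.
move=> /rowV0Pn[v vK v0].
have vB : v *m B = 0 by exact/sub_kermxP.
have [i0 hi0] : exists i, v 0 i != 0.
  apply/existsP; apply: contraNT v0; rewrite negb_exists => /forallP h.
  by apply/eqP/rowP => i; rewrite mxE; have := h i; rewrite negbK => /eqP.
pose c i := numq (v 0 i) * \prod_(j | j != i) denq (v 0 j).
pose D := \prod_j denq (v 0 j).
have cE i : (c i)%:~R = v 0 i * D%:~R :> rat.
  by rewrite /c /D [X in _ = _ * X%:~R](bigD1 i) //= !intrM numqE mulrA.
have D0 : D != 0 by apply/prodf_neq0 => j _; exact: denq_neq0.
exists c; first by exists i0; rewrite -(intr_eq0 rat) cE mulf_neq0 // intr_eq0.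
move=> j; apply/eqP; rewrite -(intr_eq0 rat) rmorph_sum /=.
have /rowP/(_ j) := vB; rewrite !mxE => h.
under eq_bigr => i _ do rewrite intrM cE -mulrA mulrCA mulrA -mulrA.
rewrite -[X in X == 0](_ : (\sum_i v 0 i * B i j) * D%:~R = _).
  by rewrite h mul0r.
by rewrite mulr_suml; apply: eq_bigr => i _; rewrite mxE; ring.
Qed.

Section Winding.
Context {R : realType} {V : eqType}.
Context {adj : V -> V -> Prop} {pos : V -> R * R} {arc : V -> V -> R -> R * R}.
Hypothesis G : is_plane_graph adj pos arc.
Implicit Types (F Phi : R * R -> R) (u v w x : V) (s : seq V) (q z : R * R).

Local Notation turn := (@turn R V pos arc).
Local Notation subgraph_img := (@subgraph_img R V pos arc).

Definition walk_img x s := subgraph_img (zip (x :: s) s) [::].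

(** For a closed walk avoiding [q], this is [2 * pi] times the winding number around [q]. *)
Definition winding x s q : R := wsum (turn (arg q)) x s.

Lemma walk_compact x s : chain adj x s -> compact (walk_img x s).
Proof. by move=> c; apply: (subgraph_compact G) => e; exact: chain_zip. Qed.

Lemma walk_closed x s : chain adj x s -> closed (walk_img x s).
Proof. by move=> c; apply: (subgraph_closed G) => e; exact: chain_zip. Qed.

Lemma wsum_telescope (f : V -> R) x s : wsum (fun u v => f v - f u) x s = f (last x s) - f x.
Proof. by elim: s x => [|y s IH] x /=; rewrite ?subrr // IH; lra. Qed.

Lemma eq_wsum (d d' : V -> V -> R) x s :
  (forall e, e \in zip (x :: s) s -> d e.1 e.2 = d' e.1 e.2) -> wsum d x s = wsum d' x s.
Proof. by rewrite !wsum_edges => h; apply: eq_big_seq. Qed.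

Lemma wsum_add (d d' : V -> V -> R) x s :
  wsum (fun u v => d u v + d' u v) x s = wsum d x s + wsum d' x s.
Proof. by rewrite !wsum_edges big_split. Qed.

Lemma ccont_walk_edge x s q e : e \in zip (x :: s) s -> ~ walk_img x s q ->
  ccont (edge_img arc e.1 e.2) (arg q).
Proof. by move=> he nq; apply: ccont_arg => h; apply: nq; left; exists e. Qed.

(** Moving [q] to a nearby [p] changes the angle by the single-valued function [h], whose increments
    cancel around a closed walk. *)
Lemma winding_locally_const x s q : chain adj x s -> last x s = x -> ~ walk_img x s q ->
  exists e : R, 0 < e /\ forall p, `|p - q| < e -> winding x s p = winding x s q.
Proof.
move=> c l nq; have [e [e0 he]] := closed_far (walk_closed c) nq.
exists (e / 2); split; first by rewrite divr_gt0.
move=> p hp.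
have np : ~ walk_img x s p.
  move=> h; have := he _ h; rewrite leNgt => /negP; apply; lra.
pose h z := branch (arg p z - arg q z).
rewrite /winding (@eq_wsum _ (fun u v => turn (arg q) u v + (h (pos v) - h (pos u)))).
  by rewrite wsum_add (wsum_telescope (h \o pos)) l subrr addr0.
move=> f hf; have a := chain_zip c hf.
have cq := ccont_walk_edge hf nq; have cp := ccont_walk_edge hf np.
have [l1 l2] := edge_islog G a cq.
rewrite (@turn_log _ _ _ _ _ G _ (fun z => logof (edge_img arc f.1 f.2) (arg q) z + h z)) //.
  by rewrite /turn; lra.
split; first by apply: within_add => //; apply: within_branch; exact: ccontB.
move=> z hz; rewrite -[X in eqang _ X](subrK (arg q z)) addrC.
apply: eqangD; last exact: l2.
apply: branchP; apply: ang_close.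
have -> : z - p - (z - q) = q - p by rewrite opprB addrC subrKA.
apply: lt_le_trans (he z _); last by left; exists f.
by rewrite distrC; lra.
Qed.

(** Local constancy makes the level set relatively open and closed in [A]. *)
Lemma winding_connected x s (A : set (R * R)) p q : chain adj x s -> last x s = x ->
  connected A -> A `<=` ~` walk_img x s -> A p -> A q -> winding x s p = winding x s q.
Proof.
move=> c l cA AK Ap Aq.
have op (P : R -> Prop) : open [set z | ~ walk_img x s z /\ P (winding x s z)].
  rewrite openE => z /= [nz Pz].
  have [e [e0 he]] := closed_far (walk_closed c) nz.
  have [e' [e0' he']] := winding_locally_const c l nz.
  apply/nbhs_planeP; exists (Num.min e e'); split; first by rewrite lt_min e0.
  move=> y; rewrite lt_min => /andP[h1 h2]; split; last by rewrite he'.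
  by move=> /he; rewrite leNgt h1.
pose B := A `&` [set z | winding x s z = winding x s q].
suff BA : B = A.
  by have [_ ->] : B p by rewrite BA.
apply: cA; first by exists q.
  exists [set z | ~ walk_img x s z /\ winding x s z = winding x s q].
    exact: (op (fun r => r = winding x s q)).
  apply/seteqP; split => z [Az] /=; first by move=> h; split => //; split => //; exact: AK.
  by move=> [_ h].
exists (~` [set z | ~ walk_img x s z /\ winding x s z <> winding x s q]).
  by apply: open_closedC; exact: (op (fun r => r <> winding x s q)).
apply/seteqP; split => z [Az] /=; first by move=> h; split => // -[_].
by move=> h; split => //=; apply: contrapT => h'; apply: h; split => //; exact: AK.
Qed.

(** Seen from far away, the walk stays within a small angle of the direction [- q], so a
    single-valued branch exists along it and its increments cancel. *)
Lemma winding_far x s : chain adj x s -> last x s = x ->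
  exists M : R, forall q, M < `|q| -> winding x s q = 0.
Proof.
move=> c l; have [B [_ hB]] := compact_bounded (walk_compact c).
have B0 : B < `|B| + 1 by rewrite (le_lt_trans (ler_norm _)) // ltrDl.
exists (2 * (`|B| + 1)) => q hq.
have bz z : walk_img x s z -> `|z| <= `|B| + 1 by move=> hz; exact: (hB _ B0).
have nq : ~ walk_img x s q by move=> /bz; have := normr_ge0 B; lra.
pose h z := branch (arg q z - ang (- q)) + ang (- q).
rewrite /winding (@eq_wsum _ (fun u v => h (pos v) - h (pos u))).
  by rewrite (wsum_telescope (h \o pos)) l subrr.
move=> f hf; have a := chain_zip c hf.
have cq := ccont_walk_edge hf nq.
apply: (turn_log G a); split.
  apply: within_add; last exact: within_cst.
  by apply: within_branch; apply: ccontB => //; apply: ccont_cont; exact: within_cst.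
move=> z hz; rewrite -[X in eqang _ X](subrK (ang (- q))).
apply: eqangD; last exact: eqang_refl.
apply: branchP; apply: ang_close; rewrite normrN addrK.
by have := bz z (or_introl (ex_intro2 _ _ f hf hz)); lra.
Qed.

Lemma eqang_wsum F x s : chain adj x s ->
  (forall e, e \in zip (x :: s) s -> ccont (edge_img arc e.1 e.2) F) ->
  eqang (wsum (turn F) x s) (F (pos (last x s)) - F (pos x)).
Proof.
elim: s x => [|y s IH] x /= => [_ _|[a c] h].
  by rewrite subrr; exact: eqang_refl.
have -> : F (pos (last y s)) - F (pos x) =
  F (pos y) - F (pos x) + (F (pos (last y s)) - F (pos y)) by lra.
apply: eqangD; last by apply: IH => // e he; apply: h; rewrite inE he orbT.
by apply: (turn_eqang G a); apply: (h (x, y)); rewrite inE eqxx.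
Qed.

Lemma zip_split x s (e : V * V) : e \in zip (x :: s) s ->
  exists s1 s2, s = s1 ++ e.2 :: s2 /\ e.1 = last x s1.
Proof.
elim: s x => [|y s IH] x //=; rewrite inE => /orP[/eqP ->|/IH[s1 [s2 [-> ->]]]].
  by exists [::], s.
by exists (y :: s1), s2.
Qed.

Lemma zip_subset x s1 s2 :
  {subset zip (x :: s1) s1 <= zip (x :: s1 ++ s2) (s1 ++ s2)}.
Proof.
move=> f; elim: s1 x => [|y s1 IH] x //=; rewrite !inE => /orP[->//|/IH ->].
exact: orbT.
Qed.

Lemma cycle_imgE x s : cycle_img arc x s = walk_img x (rcons s x).
Proof.
have e : zip (x :: s) (rcons s x) = zip (x :: rcons s x) (rcons s x).
  by elim: s {1 3}x => [|y s IH] z //=; rewrite -IH.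
apply/seteqP; split => z /=.
  by move=> [f [hf hz]]; left; exists f; rewrite -?e.
by move=> [[f hf hz]|[v //]]; exists f; rewrite e.
Qed.

(** If the winding vanished, the partial sums of the turning would be consistent vertex angles on
    the cycle; the resulting logarithm of [arg p] contradicts [bounded_component_degree] with
    [n = 1] and [H = 0]. *)
Lemma winding_inside x s p : is_cycle adj x s -> inside (cycle_img arc x s) p ->
  winding x (rcons s x) p <> 0.
Proof.
rewrite cycle_imgE => -[us _ c] [np bp] w0.
have wr0 : wsum (turn (arg p)) x s + turn (arg p) (last x s) x = 0.
  by move: w0; rewrite /winding -cats1 wsum_cat /= addr0.
(* The vertices of a cycle are distinct, so [index] gives the position of [v] unambiguously. *)
pose theta v := arg p (pos x) + wsum (turn (arg p)) x (take (index v (x :: s)) s).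
have thE s1 s2 : s = s1 ++ s2 -> theta (last x s1) = arg p (pos x) + wsum (turn (arg p)) x s1.
  move=> es; rewrite /theta; congr (_ + wsum _ _ _).
  have -> : index (last x s1) (x :: s) = size s1.
    rewrite es -cat_cons index_cat mem_last index_last //.
    by move: us; rewrite es -cat_cons cat_uniq => /andP[].
  by rewrite es take_size_cat.
have ce e : e \in zip (x :: rcons s x) (rcons s x) -> ccont (edge_img arc e.1 e.2) (arg p).
  by move=> he; exact: ccont_walk_edge he np.
have [|||Phi [cPhi ePhi]] := @subgraph_log _ _ _ _ _ G (zip (x :: rcons s x) (rcons s x)) [::]
    (arg p) theta (fun e => chain_zip c (e:=e)).
- exact: ccont_arg.
- move=> v; rewrite inE => -[[e he hv]|[? //]].
  have vs : v \in x :: s.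
    have [m1 m2] := zip_mem he.
    have : v \in x :: rcons s x by case: (edge_pos G (chain_zip c he) hv) => ->.
    by rewrite !inE mem_rcons inE; case: eqP.
  have [s1 [s2 [es <- _ _]]] : exists s1 s2, [/\ s = s1 ++ s2, last x s1 = v, chain adj x s1 & chain adj v s2].
    by apply: chain_mem => //; move: c; rewrite -cats1 chain_cat => -[].
  rewrite (thE _ _ es) -[X in eqang _ X](subrK (arg p (pos x))) addrC.
  apply: eqangD; last exact: eqang_refl.
  have zs : {subset zip (x :: s1) s1 <= zip (x :: rcons s x) (rcons s x)}.
    by rewrite es -cats1 -catA; exact: zip_subset.
  apply: eqang_wsum => [|f /zs]; last exact: ce.
  by move: c; rewrite es -cats1 -catA chain_cat => -[].
- move=> e /zip_split[s1 [s2 [es ->]]].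
  (* An empty [s2] singles out the closing edge, where the vanishing of the total enters. *)
  case/lastP: s2 es => [|s2 y] es.
    have [e1 e2] : s = s1 /\ x = e.2 by move: es; rewrite cats1 => /rcons_inj[].
    rewrite -e2 -e1 (thE s [::]) ?cats0 // (thE [::] s) //=.
    by apply/eqP; rewrite addr0 opprD addrA subrr add0r; lra.
  have [es' _] : s = s1 ++ e.2 :: s2 /\ x = y.
    by move: es; rewrite -rcons_cons -rcons_cat => /rcons_inj[].
  rewrite (thE _ _ es').
  have -> : e.2 = last x (rcons s1 e.2) by rewrite last_rcons.
  rewrite (thE _ s2) ?cat_rcons // last_rcons -cats1 wsum_cat /=; lra.
suff : (1 : int) = 0 by [].
apply: (@bounded_component_degree _ (walk_img x (rcons s x)) p 1 (fun=> 0) Phi) => //.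
- exact: walk_closed.
- by apply: ccont_cont; exact: within_cst.
- by move=> z hz; rewrite mul1r addr0; exact: ePhi.
Qed.

(* At most one bounded complementary component per edge: otherwise some integer
   combination of the angle functions would have a continuous logarithm. *)
Lemma bounded_components_le E T (qs : seq (R * R)) :
  (forall e, e \in E -> adj e.1 e.2) -> uniq qs ->
  (forall q, q \in qs -> ~ subgraph_img E T q) ->
  (forall q, q \in qs -> bounded2 (connected_component (~` subgraph_img E T) q)) ->
  (forall p q, p \in qs -> q \in qs ->
    connected_component (~` subgraph_img E T) p q -> p = q) ->
  (size qs <= size E)%N.
Proof.
move=> aE uq nq bq dq; rewrite leqNgt; apply/negP => lt.
set K := subgraph_img E T in nq bq dq *.
pose q_ i := tnth (in_tuple qs) i; pose e_ j := tnth (in_tuple E) j.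
have qin i : q_ i \in qs by exact: mem_tnth.
have ein j : e_ j \in E by exact: mem_tnth.
have cK i : ccont K (arg (q_ i)) by apply: ccont_arg; exact: nq.
have ce i e : e \in E -> ccont (edge_img arc e.1 e.2) (arg (q_ i)).
  by move=> eE; apply: ccont_sub (cK i) => z ez; left; exists e.
(* The integer defect between the turning along an edge and the difference of the principal angles
   at its ends. *)
have intN i j : exists k : int, turn (arg (q_ i)) (e_ j).1 (e_ j).2 -
    (arg (q_ i) (pos (e_ j).2) - arg (q_ i) (pos (e_ j).1)) = k%:~R * (pi *+ 2).
  by apply: eqang_int; apply: (turn_eqang G (aE _ (ein j))); exact: ce.
have [c [i0 ci0] hc] := int_relation (fun i j => projT1 (cid (intN i j))) lt.
pose F z := \sum_i (c i)%:~R * arg (q_ i) z.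
have cF : ccont K F by apply: ccont_sum => i; apply: ccontMz.
(* The relation cancels the defects of [F], so the values of [F] itself serve as vertex angles. *)
have [|Phi [cPhi ePhi]] := @subgraph_log _ _ _ _ _ G E T F (F \o pos) aE cF
    (fun v _ => eqang_refl _).
  move=> e eE; rewrite /F (@turn_sum _ _ _ _ _ G _ _ c (fun i => arg (q_ i)) _ _
    (aE _ eE) (fun i => ce i _ eE)).
  have [j ej] : exists j, e = e_ j by exact/(@tnthP _ _ (in_tuple E)).
  apply/eqP; rewrite -subr_eq0 /= -sumrB -sumrB.
  have /(congr1 (fun k : int => k%:~R * (pi *+ 2) : R)) := hc j.
  rewrite mul0r rmorph_sum /= mulr_suml => h; apply/eqP; rewrite -[RHS]h.
  apply: eq_bigr => i _; case: cid => k /=; rewrite -ej => hk.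
  by rewrite intrM -mulrA -hk; ring.
apply/negP: ci0; rewrite negbK; apply/eqP.
(* The terms of [F] other than [i0]; their points lie in other components, so [H] has no singularity
   on the component of [q_ i0]. *)
pose H z := \sum_i (if i == i0 then 0 else c i)%:~R * arg (q_ i) z.
apply: (@bounded_component_degree _ K (q_ i0) (c i0) H Phi) => //.
- exact: (subgraph_closed G).
- exact: nq.
- exact: bq.
- apply: ccont_sum => i; case: eqP => [_|ne].
    apply: (ccont_eqang _ (ccont_cont (within_cst (a := 0)))) => z _.
    by rewrite mul0r; exact: eqang_refl.
  apply: ccontMz; apply: ccont_arg => -[Uqi|]; last exact: nq.
  have := dq _ _ (qin i0) (qin i) Uqi; rewrite /q_ !(tnth_nth 0) /= => /eqP.
  by rewrite nth_uniq // => /eqP/val_inj/esym.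
- move=> z Kz; apply: eqang_trans (ePhi z Kz) _.
  suff -> : F z = (c i0)%:~R * arg (q_ i0) z + H z by exact: eqang_refl.
  rewrite /F /H (bigD1 i0) //= [in RHS](bigD1 i0) //= eqxx mul0r add0r.
  by congr (_ + _); apply: eq_bigr => i /negbTE ->.
Qed.

End Winding.

(** * Closed walks in hyperbolic graphs *)

Section Hyperbolic.
Context {V : eqType} {adj : V -> V -> Prop}.
Hypothesis adjC : forall u v, adj u v -> adj v u.
Implicit Types (u v w x y z : V) (s : seq V).

Lemma geodesic_ex u s : chain adj u s ->
  exists s', geodesic adj u (last u s) s' /\ (size s' <= size s)%N.
Proof.
move=> c; pose P n := `[< exists s', [/\ chain adj u s', last u s' = last u s & size s' = n] >].
have ex : exists n, P n by exists (size s); apply/asboolP; exists s.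
case: (ex_minnP ex) => n /asboolP[s' [c' l' e']] hm.
exists s'; rewrite e'; split; last by apply: hm; apply/asboolP; exists s.
split => //; rewrite e'; split; first by exists s'.
by move=> t ct lt; apply: hm; apply/asboolP; exists t.
Qed.

Lemma gdist_uniq u v m n : gdist adj u v m -> gdist adj u v n -> m = n.
Proof.
move=> [[s [c l <-]] h] [[t [c' l' <-]] h'].
by apply/eqP; rewrite eqn_leq h // h'.
Qed.

Lemma gdistC u v n : gdist adj u v n -> gdist adj v u n.
Proof.
move=> [[s [c l <-]] h]; split.
  exists (wrev u s); rewrite -l size_wrev last_wrev; split => //.
  exact: chain_wrev.
move=> t ct lt; have := h (wrev v t); rewrite size_wrev -lt last_wrev; apply => //.
exact: chain_wrev.
Qed.

Lemma gdist_le_add u v w a b c : gdist adj u v a -> gdist adj v w b -> gdist adj u w c ->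
  (c <= a + b)%N.
Proof.
move=> [[s [cs ls <-]] _] [[t [ct lt <-]] _] [_ h]; rewrite -size_cat.
by apply: h; rewrite ?chain_cat ?last_cat ls.
Qed.

Lemma geodesic_split u v s w : geodesic adj u v s -> w \in u :: s ->
  exists a b, [/\ gdist adj u w a, gdist adj w v b & (a + b)%N = size s].
Proof.
move=> [c l [_ h]] wi; have [s1 [s2 [es l1 c1 c2]]] := chain_mem wi c.
have l2 : last w s2 = v by rewrite -l es last_cat l1.
exists (size s1), (size s2); rewrite es size_cat; split => //.
  split; first by exists s1.
  move=> t ct lt; rewrite -(leq_add2r (size s2)) -!size_cat -es.
  by apply: h; rewrite ?chain_cat ?last_cat lt.
split; first by exists s2.
move=> t ct lt; rewrite -(leq_add2l (size s1)) -!size_cat -es.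
by apply: h; rewrite ?chain_cat ?last_cat l1.
Qed.

Lemma gdist_refl u n : gdist adj u u n -> n = 0%N.
Proof. by move=> [_ h]; apply/eqP; rewrite -leqn0; exact: (h [::]). Qed.

Variable delta : nat.
Hypothesis thin : forall (x y z : V) (sxy syz szx : seq V),
  geodesic adj x y sxy -> geodesic adj y z syz -> geodesic adj z x szx ->
  forall w, w \in x :: sxy ->
    exists w', (w' \in y :: syz \/ w' \in z :: szx) /\
               exists d, gdist adj w w' d /\ (d <= delta)%N.

(** Strictly above [2 * delta], so that a stretch of length [L] outweighs two errors of size
    [delta]. *)
Let L := (2 * delta).+1.

(* If every subwalk of length at most [2 * L] were geodesic, then thinness of the
   triangle spanned by [x] and the two points at walk-distance [L] from a point
   farthest from [x] would keep the whole walk within [delta] of [x], while its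
   first [L] steps lead to distance [L]. *)
Lemma closed_walk_shortcut x s : chain adj x s -> last x s = x -> s != [::] ->
  exists s1 s2 s3, [/\ s = s1 ++ s2 ++ s3, (size s2 <= 2 * L)%N &
    ~ geodesic adj (last x s1) (last (last x s1) s2) s2].
Proof.
move=> c l sn; apply: contrapT => no.
have H s1 s2 s3 : s = s1 ++ s2 ++ s3 -> (size s2 <= 2 * L)%N ->
    geodesic adj (last x s1) (last (last x s1) s2) s2.
  by move=> e1 e2; apply: contrapT => e3; apply: no; exists s1, s2, s3.
set n := size s.
(* A closed walk of length at most [2 * L] would itself be a geodesic from [x] to [x], hence
   empty. *)
have n2L : (2 * L < n)%N.
  rewrite ltnNge; apply/negP => h.
  have [_ _] := H [::] s [::] (esym (cats0 s)) h; rewrite /= l => /gdist_refl.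
  by case: (s) sn.
pose w i := last x (take i s).
pose seg a b := take (b - a) (drop a s).
have takeE a b : (a <= b)%N -> take b s = take a s ++ seg a b.
  by move=> ab; rewrite -{1}(subnKC ab) takeD.
have lseg a b : (a <= b)%N -> last (w a) (seg a b) = w b.
  by move=> ab; rewrite /w (takeE a b) // last_cat.
have segD a j b : (a <= j)%N -> (j <= b)%N -> seg a b = seg a j ++ seg j b.
  move=> aj jb; rewrite /seg.
  have -> : (b - a = (j - a) + (b - j))%N by lia.
  by rewrite takeD drop_drop subnK.
have szseg a b : (a <= b)%N -> (b <= n)%N -> size (seg a b) = (b - a)%N.
  by move=> ab bn; rewrite size_takel // size_drop leq_sub2r.
have Hseg a b : (a <= b)%N -> (b <= n)%N -> (b - a <= 2 * L)%N ->
    geodesic adj (w a) (w b) (seg a b).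
  move=> ab bn h; rewrite -(lseg a b) //; apply: (H _ _ (drop b s)); last by rewrite szseg.
  by rewrite catA -takeE // cat_take_drop.
have dseg a b : (a <= b)%N -> (b <= n)%N -> (b - a <= 2 * L)%N -> gdist adj (w a) (w b) (b - a).
  by move=> ab bn h; have [_ _] := Hseg _ _ ab bn h; rewrite szseg.
have w0 : w 0%N = x by rewrite /w take0.
have wn : w n = x by rewrite /w take_size.
have Dex i : exists t, geodesic adj x (w i) t.
  have [|t [ht _]] := @geodesic_ex x (take i s); last by exists t.
  by move: c; rewrite -{1}(cat_take_drop i s) chain_cat => -[].
pose gt i := projT1 (cid (Dex i)).
have gtP i : geodesic adj x (w i) (gt i) by rewrite /gt; case: cid.
pose D i := size (gt i).
have DP i : gdist adj x (w i) (D i) by case: (gtP i).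
pose j := [arg max_(i > ord0 : 'I_n.+1) D i].
have jmax i : (i <= n)%N -> (D i <= D j)%N.
  move=> hi; have hi' : (i < n.+1)%N by [].
  by rewrite /j; case: arg_maxnP => // k _ /(_ (Ordinal hi') isT).
have jn : (j <= n)%N by rewrite -ltnS.
suff Dj : (D j <= delta)%N.
  have Ln : (L <= n)%N by lia.
  have h1 : gdist adj x (w L) L by rewrite -{1}w0 -{2}[L]subn0; apply: dseg => //; lia.
  by have := jmax _ Ln; rewrite (gdist_uniq (DP L) h1) /L; lia.
(* Truncation at an end of the walk makes [w a] or [w b] equal to [x], the second alternative in
   [key]. *)
pose a := (j - L)%N; pose b := minn (j + L) n.
have aj : (a <= j)%N by rewrite leq_subr.
have jb : (j <= b)%N by rewrite leq_min leq_addr.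
have bn : (b <= n)%N by rewrite geq_minr.
have gab : geodesic adj (w a) (w b) (seg a b) by apply: Hseg; rewrite /a /b; lia.
have gbx : exists t, geodesic adj (w b) x t.
  exists (wrev x (gt b)); have [c1 l1 d1] := gtP b.
  split; rewrite ?size_wrev; last exact: gdistC.
    by rewrite -l1; exact: chain_wrev.
  by rewrite -l1 last_wrev.
have [t gt'] := gbx.
have jin : w j \in w a :: seg a b.
  rewrite (segD a j b) // -cat_cons mem_cat; apply/orP; left.
  by rewrite -(lseg a j) // mem_last.
have [w' [hw' [d [hd dd]]]] := thin gab gt' (gtP a) jin.
have dxj := gdistC (DP j).
(* If [w k] is at distance [L] from [w j], then [D k = p + q >= (L - d) + (D j - d) > D j], against
   the choice of [j]. If [w k = x], then [D k = 0] forces [w' = x] and [D j <= d]. *)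
have key k p q : (k <= n)%N -> gdist adj (w k) w' p -> gdist adj w' x q -> (p + q = D k)%N ->
    (exists2 m, gdist adj (w j) (w k) m & (m = L) \/ w k = x) -> (D j <= delta)%N.
  move=> kn hp hq e [m hm hor].
  have t1 := gdist_le_add hd hq dxj.
  have t2 := gdist_le_add hd (gdistC hp) hm.
  case: hor => [mL|kx].
    by have := jmax _ kn; move: t1 t2 e; rewrite mL /L; lia.
  have Dk0 : D k = 0%N by apply: (@gdist_refl x); have := DP k; rewrite kx.
  by move: t1 e; rewrite Dk0; lia.
case: hw' => [wb|wa].
  have [p [q [hp hq e]]] := geodesic_split gt' wb.
  apply: (key b p q) => //.
    by rewrite e; apply: (gdist_uniq (gdistC _) (DP b)); case: gt'.
  exists (b - j)%N; first by apply: dseg => //; rewrite /b; lia.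
  have [h|h] := leqP (j + L) n; first by left; rewrite /b; lia.
  by right; rewrite -[RHS]wn; congr w; rewrite /b; lia.
have [p [q [hp hq e]]] := geodesic_split (gtP a) wa.
apply: (key a q p); [lia|exact: gdistC|exact: gdistC|by rewrite addnC|].
exists (j - a)%N; first by apply: gdistC; apply: dseg => //; rewrite /a; lia.
have [h|h] := leqP L j; first by left; rewrite /a; lia.
by right; rewrite -[RHS]w0; congr w; rewrite /a; lia.
Qed.

(** Each shortcut splits off the closed walk formed by [s2] and its reversed geodesic replacement,
    of length at most [4 * L], and shortens the rest. Testing against all antisymmetric [d]
    expresses equality in the cycle space. *)
Lemma closed_walk_decomposition (R : realType) x s : chain adj x s -> last x s = x ->
  exists Ws : seq (V * seq V), [/\ (size Ws <= size s)%N,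
    forall W, W \in Ws -> [/\ chain adj W.1 W.2, last W.1 W.2 = W.1 & (size W.2 <= 4 * L)%N] &
    forall d : V -> V -> R, (forall u v, adj u v -> d v u = - d u v) ->
      wsum d x s = \sum_(W <- Ws) wsum d W.1 W.2].
Proof.
have [n] := ubnP (size s); elim: n s => // n IH s hn c l.
have [->|sn] := eqVneq s [::]; first by exists [::]; split => // d _; rewrite big_nil.
have [s1 [s2 [s3 [es sz ng]]]] := closed_walk_shortcut c l sn.
move: c; rewrite es !chain_cat => -[c1 [c2 c3]].
set a := last x s1 in ng c2 c3.
have [s2' [[c2' l2' d2'] sz2]] := geodesic_ex c2.
have lt : (size s2' < size s2)%N.
  rewrite ltn_neqAle sz2 andbT; apply/eqP => e; apply: ng; split => //.
  by rewrite -e.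
have [||| Ws [h1 h2 h3]] := IH (s1 ++ s2' ++ s3).
- by move: hn; rewrite es !size_cat; lia.
- by rewrite !chain_cat -/a l2'.
- by rewrite !last_cat -/a l2' -[RHS]l es !last_cat.
exists ((a, s2 ++ wrev a s2') :: Ws); split.
- by move: h1; rewrite /= !size_cat; lia.
- move=> W; rewrite inE => /orP[/eqP -> /=|/h2 //]; split.
  + by rewrite chain_cat -l2'; split => //; exact: chain_wrev.
  + by rewrite last_cat -l2' last_wrev.
  + by rewrite size_cat size_wrev; lia.
- move=> d hd; have hw := wsum_wrev c2' hd; rewrite l2' in hw.
  by rewrite big_cons -h3 //= !wsum_cat -/a l2' hw; lra.
Qed.

End Hyperbolic.

(** * Faces enclosed by short closed walks *)

Lemma size_le_cover (T : eqType) (I : eqType) (Ws : seq I) (P : I -> pred T) (ps : seq T) B :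
  (forall W, W \in Ws -> (count (P W) ps <= B)%N) ->
  (forall p, p \in ps -> exists2 W, W \in Ws & P W p) -> (size ps <= B * size Ws)%N.
Proof.
elim: Ws ps => [|W Ws IH] ps hB hP.
  by case: ps hB hP => // p ps _ /(_ p (mem_head _ _))[].
rewrite -(count_predC (P W) ps) mulnS leq_add ?hB ?mem_head //.
rewrite -size_filter; apply: IH => [W' hW'|p].
  apply: leq_trans (hB W' _); last by rewrite inE hW' orbT.
  by rewrite count_filter; apply: sub_count => p /andP[].
rewrite mem_filter => /andP[/= nP pin]; have [W' + hP'] := hP _ pin.
rewrite inE => /orP[/eqP e|]; last by exists W'.
by move: nP; rewrite -e hP'.
Qed.

Section FacesInsideShortWalks.
Context {R : realType} {V : eqType}.
Context {adj : V -> V -> Prop} {pos : V -> R * R} {arc : V -> V -> R -> R * R}.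
Hypothesis G : is_plane_graph adj pos arc.
Hypothesis acc : no_accumulation pos.
Implicit Types (u v w x : V) (s : seq V) (q z : R * R).

Local Notation walk_img := (@walk_img R V pos arc).
Local Notation winding := (@winding R V pos arc).
Local Notation subgraph_img := (@subgraph_img R V pos arc).

Let adjC u v : adj u v -> adj v u.
Proof. by case: G => [[h _] _ _ _ _]; exact: h. Qed.

Let posI : injective pos.
Proof. by case: G. Qed.

Lemma finite_vertices (M : R) : exists T : seq V, forall v, `|pos v| <= M -> v \in T.
Proof.
(* The filter of all sufficiently large lists; compactness of the box then merges the local lists,
   each with at most one vertex, into one. *)
pose Fl : set_system (seq V) := 
  filter_from setT (fun l0 : seq V => [set l : seq V | {subset l0 <= l}]).
have FF : Filter Fl.
  apply: filter_from_filter; first by exists [::].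
  move=> l1 l2 _ _; exists (l1 ++ l2) => // l h; split => v hv; apply: h.
    by rewrite mem_cat hv.
  by rewrite mem_cat hv orbT.
have /compact_near_coveringP/(_ _ Fl (fun l z => forall v, pos v = z -> v \in l) FF) :=
  @compact_box R M.
case.
  move=> z _; have [e [e0 he]] := acc z.
  have [l0 hl0] : exists l0 : seq V, forall v, `|pos v - z| < e -> v \in l0.
    have [[v0 ev0]|nv] := pselect (exists v, pos v = z).
      exists [:: v0] => v hv; rewrite inE; apply/eqP/posI; rewrite ev0; apply: he.
        by apply: le_lt_trans hv; exact: (plane_norm1 (pos v - z)).
      by apply: le_lt_trans hv; exact: (plane_norm2 (pos v - z)).
    exists [::] => v hv; exfalso; apply: nv; exists v; apply: he.
      by apply: le_lt_trans hv; exact: (plane_norm1 (pos v - z)).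
    by apply: le_lt_trans hv; exact: (plane_norm2 (pos v - z)).
  exists ([set y | `|y - z| < e], [set l : seq V | {subset l0 <= l}]) => /=.
    split; last by exists l0.
    by apply/nbhs_planeP; exists e.
  by move=> [y l] /= [hy hl] v ev; apply: hl; apply: hl0; rewrite ev.
move=> l _ hl; exists l => v hv.
by apply: (hl l _ (pos v)).
Qed.

(** The trivial walk is excluded: it visits [x] but has empty image. *)
Lemma pos_walk_img x s v : chain adj x s -> s != [::] ->
  walk_img x s (pos v) <-> v \in x :: s.
Proof.
move=> c sn; split.
  move=> [[e he hv]|[//]]; have [m1 m2] := zip_mem he.
  by case: (edge_pos G (chain_zip c he) hv) => ->.
move=> /(mem_zip sn)[e [he hv]]; have a := chain_zip c he; left; exists e => //.
by case: hv => ->; [exact: (edge_pos1 G a)|exact: (edge_pos2 G a)].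
Qed.

(* The part of the edge between [u] and [z] avoids the walk. *)
Lemma winding_edge x s u v z : chain adj x s -> last x s = x -> s != [::] -> adj u v ->
  edge_img arc u v z -> ~ walk_img x s z -> u \notin x :: s ->
  winding x s (pos u) = winding x s z.
Proof.
move=> c l sn a [t tI ez] nz us.
have [_ _ h3 _ h5] := G; have [ca ia a0 a1 _] := h3 _ _ a.
have t01 : 0 <= t <= 1 by move: tI; rewrite /= in_itv.
have sub : `[0, t] `<=` [set r | r \in `[(0:R), 1]].
  move=> r /=; rewrite !in_itv /= => /andP[r0 rt].
  by case/andP: t01 => _; rewrite r0 /=; exact: le_trans.
apply: (@winding_connected _ _ _ _ _ G x s (arc u v @` `[0, t]%classic)) => //.
- apply: connected_continuous_connected; first exact: segment_connected.
  exact: continuous_subspaceW sub ca.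
- move=> y [r rI ey] /= yK; have rI1 := sub _ rI.
  case: (yK) => [[e he hy]|[//]]; have ae := chain_zip c he; have [m1 m2] := zip_mem he.
  have ne : ~ (u = e.1 /\ v = e.2 \/ u = e.2 /\ v = e.1).
    by case=> -[e1 _]; move: us; rewrite e1 ?m1 ?m2.
  have ey' : edge_img arc u v y by exists r.
  have [w [hw1 hw2 ew]] := h5 _ _ _ _ _ a ae ne ey' hy.
  have ws : w \in x :: s by case: hw2 => ->.
  (* As [u] is off the walk, the meeting point is the position of [v]; then [r = t = 1] and [z]
     would lie on the walk. *)
  case: hw1 => e1; first by move: us; rewrite -e1 ws.
  have r1 : r = 1.
    by apply: ia => //; [rewrite in_itv /= ler01 lexx|rewrite ey ew a1 e1].
  have t1 : t = r.
    by apply/eqP; rewrite eq_le; move: rI t01; rewrite r1 /= in_itv /= => /andP[_ ->] /andP[_ ->].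
  by apply: nz; rewrite -ez t1 ey.
- exists 0 => //=; by rewrite in_itv /= lexx; case/andP: t01.
- exists t => //=; by rewrite in_itv /= lexx andbT; case/andP: t01.
Qed.

Variable f : nat -> nat.
Hypothesis f_homo : forall m n, (m <= n)%N -> (f m <= f n)%N.
Hypothesis f_bound : forall S b : seq V, uniq S -> S != [::] -> is_boundary adj S b ->
  (size S <= f (size b))%N.

(** The enclosed vertices [S] and the walk span a finite graph which contains every point of [G] of
    non-zero winding off the walk. Hence distinct faces give distinct components of its complement,
    bounded since the winding vanishes far away, and [bounded_components_le] applies. *)
Lemma short_walk_faces x s N (ps : seq (R * R)) :
  chain adj x s -> last x s = x -> (size s <= N)%N -> uniq ps ->
  (forall p, p \in ps -> ~ graph_img adj pos arc p /\ winding x s p <> 0) ->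
  (forall p q, p \in ps -> q \in ps -> face adj pos arc p q -> p = q) ->
  (size ps <= (f N.+1 + N.+1) ^ 2)%N.
Proof.
move=> c l sN ups hps dps.
have [s0|sn] := eqVneq s [::].
  case: ps hps {ups dps} => // p ps /(_ p (mem_head _ _))[_ []].
  by rewrite s0.
have [M hM] := winding_far G c l; have [T0 hT0] := finite_vertices M.
pose S := [seq v <- undup T0 | `[< v \notin x :: s /\ winding x s (pos v) <> 0 >]].
have SP v : v \in S <-> v \notin x :: s /\ winding x s (pos v) <> 0.
  rewrite mem_filter mem_undup; split=> [/andP[/asboolP//]|h].
  apply/andP; split; first exact/asboolP.
  by apply: hT0; rewrite leNgt; apply/negP => /hM; case: h.
(* From an endpoint off the walk, the winding stays constant along the edge up to [z]. *)
have edge_in u v z : adj u v -> edge_img arc u v z -> ~ walk_img x s z ->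
    winding x s z <> 0 -> u \in S ++ x :: s.
  move=> a ez nz wz; rewrite mem_cat; have [us|us] := boolP (u \in x :: s); first exact: orbT.
  by rewrite orbF; apply/SP; split => //; rewrite (winding_edge c l sn a ez nz us).
have nK v : v \in S -> ~ walk_img x s (pos v).
  by move=> /SP[vs _] /(pos_walk_img _ c sn); apply/negP.
have szS : (size S <= f N.+1)%N.
  have [->//|S0] := eqVneq S [::].
  (* Every boundary vertex of [S] lies on the walk, which has at most [N.+1] entries: [x] and those
     of [s]. *)
  pose b := [seq v <- undup (x :: s) | `[< exists y, y \in S /\ adj v y >]].
  have sb : (size b <= N.+1)%N.
    apply: leq_trans (_ : size (undup (x :: s)) <= _)%N.
      by rewrite size_filter; exact: count_size.
    by apply: leq_trans (size_undup _) _.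
  apply: leq_trans (f_homo sb); apply: f_bound => //.
    by rewrite filter_uniq // undup_uniq.
  split; first by rewrite filter_uniq // undup_uniq.
  move=> v; rewrite mem_filter mem_undup; split=> [/andP[/asboolP h vs]|[vS [y [yS a]]]].
    by split => //; apply/negP => /SP[/negP].
  apply/andP; split; first by apply/asboolP; exists y.
  have := edge_in v y (pos y) a (edge_pos2 G a) (nK _ yS) ((SP y).1 yS).2.
  by rewrite mem_cat (negbTE vS).
pose T := S ++ x :: s.
have szT : (size T <= f N.+1 + N.+1)%N by rewrite size_cat leq_add.
(* Edges are listed as ordered pairs from [T], whence the square in the bound. *)
pose E := [seq e <- [seq (u, v) | u <- T, v <- T] | `[< adj e.1 e.2 >]].
have EP u v : u \in T -> v \in T -> adj u v -> (u, v) \in E.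
  move=> uT vT a; rewrite mem_filter; apply/andP; split; first exact/asboolP.
  by apply/allpairsP; exists (u, v).
have aE e : e \in E -> adj e.1 e.2 by rewrite mem_filter => /andP[/asboolP].
have szE : (size E <= (f N.+1 + N.+1) ^ 2)%N.
  apply: leq_trans (_ : size T * size T <= _)%N; last by rewrite -mulnn leq_mul.
  by rewrite size_filter (leq_trans (count_size _ _)) // size_allpairs.
apply: leq_trans szE.
have KK' : walk_img x s `<=` subgraph_img E S.
  move=> z [[e he ez]|[//]]; left; exists e => //; have [m1 m2] := zip_mem he.
  by case: e he ez m1 m2 => u v /= he ez m1 m2; apply: EP; rewrite ?mem_cat ?m1 ?m2 ?orbT //;
    exact: (chain_zip c he).
have K'G : subgraph_img E S `<=` graph_img adj pos arc.
  move=> z [[e he ez]|[v _ ->]]; last by left; exists v.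
  by right; exists e.1, e.2; split => //; exact: aE.
have GK' z : graph_img adj pos arc z -> ~ walk_img x s z -> winding x s z <> 0 ->
    subgraph_img E S z.
  move=> [[v ->]|[u [v [a ez]]]] nz wz.
    right; exists v => //; apply/SP; split => //.
    by apply/negP => /(pos_walk_img _ c sn).
  left; exists (u, v) => //; apply: EP => //; first exact: edge_in a ez nz wz.
  by apply: (edge_in v u z (adjC a)) => //; rewrite (edge_imgC G a).
have comp p z : p \in ps -> connected_component (~` subgraph_img E S) p z ->
    ~ walk_img x s z /\ winding x s z <> 0.
  move=> pin hz; have [np wp] := hps _ pin.
  have sub : connected_component (~` subgraph_img E S) p `<=` ~` walk_img x s.
    by move=> y /connected_component_sub nK' /KK'.
  split; first exact: sub.
  have cp : connected_component (~` subgraph_img E S) p p.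
    by apply: connected_component_refl => /K'G.
  by rewrite -(winding_connected G c l (@component_connected _ _ p) sub cp hz).
apply: (bounded_components_le G (E := E) (T := S)) => //.
- by move=> q /hps[nq _] /K'G.
- move=> q qin; exists M => z hz; have [_ wz] := comp _ _ qin hz.
  have zM : `|z| <= M by rewrite leNgt; apply/negP => /hM.
  by split; apply: le_trans zM; [exact: plane_norm1|exact: plane_norm2].
(* No point of the graph lies in the component of [p], so that component is contained in the face of
   [p]. *)
- move=> p q pin qin h; apply: dps => //.
  have [np _] := hps _ pin.
  apply: (connected_component_max _ _ _ h); last exact: component_connected.
    by apply: connected_component_refl => /K'G.
  move=> z hz gz; have [nz wz] := comp _ _ pin hz.
  exact: (connected_component_sub hz) (GK' _ gz nz wz).
Qed.

End FacesInsideShortWalks.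

(** * Summing over the short closed walks *)

Theorem lemma5p2 (R : realType) (V : eqType) (adj : V -> V -> Prop)
    (pos : V -> R * R) (arc : V -> V -> R -> R * R) :
  is_plane_graph adj pos arc ->
  no_accumulation pos ->
  bounded_degree adj ->
  hyperbolic adj ->
  weakly_nonamenable adj ->
  exists k : nat, forall (x : V) (s : seq V), is_cycle adj x s ->
    forall ps : seq (R * R),
      distinct_faces_inside adj pos arc (cycle_img arc x s) ps ->
      (size ps <= k * (size s).+1)%N.
Proof.
move=> G acc _ [delta thin] [f [f_homo _ f_bound]].
have adjC u v : adj u v -> adj v u by case: G => [[h _] _ _ _ _]; exact: h.
(* The length bound on the walks from [closed_walk_decomposition]. *)
pose N := (4 * (2 * delta).+1)%N.
exists ((f N.+1 + N.+1) ^ 2)%N => x s cyc ps [ps_in ps_dist].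
have c : chain adj x (rcons s x) by case: cyc.
have face_refl p : p \in ps -> face adj pos arc p p.
  by move=> /ps_in[np _]; exact: connected_component_refl.
have dps p q : p \in ps -> q \in ps -> face adj pos arc p q -> p = q.
  move=> pin qin h; apply: contrapT => ne.
  have ip : (index p ps < size ps)%N by rewrite index_mem.
  have iq : (index q ps < size ps)%N by rewrite index_mem.
  apply: (ps_dist _ _ ip iq); last by rewrite !nth_index.
  by move=> e; apply: ne; rewrite -(nth_index 0 pin) e nth_index.
have ups : uniq ps.
  apply/(uniqP 0) => i j; rewrite !inE => hi hj e; apply: contrapT => ne.
  by apply: (ps_dist _ _ hi hj ne); rewrite -e; apply: face_refl; exact: mem_nth.
have [Ws [szW hW sumW]] := closed_walk_decomposition adjC thin R c (last_rcons _ _ _).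
rewrite -(size_rcons s x); apply: leq_trans (_ : (f N.+1 + N.+1) ^ 2 * size Ws <= _)%N; last first.
  by rewrite leq_mul2l szW orbT.
(* Each face is charged to a short walk with non-zero winding around it; one exists because the
   windings add up to that of the cycle. *)
apply: (size_le_cover (P := fun W p => `[< @winding R V pos arc W.1 W.2 p <> 0 >])).
  move=> W /hW[cW lW sW]; rewrite -size_filter.
  apply: (short_walk_faces G acc f_homo f_bound cW lW sW); first exact: filter_uniq.
    by move=> p; rewrite mem_filter => /andP[/asboolP wp /ps_in[np _]].
  by move=> p q; rewrite !mem_filter => /andP[_ pin] /andP[_ qin]; exact: dps.
move=> p pin; have [_ fin] := ps_in _ pin.
have wp := winding_inside G cyc (fin _ (face_refl _ pin)).
apply: contrapT => no; apply: wp.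
rewrite /winding (sumW _ (fun u v a => turnC G (arg p) a)).
apply: big1_seq => W /= WW; apply: contrapT => nz; apply: no.
by exists W => //; apply/asboolP.
Qed.
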